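(* Let $m,n\ge 2$ be integers. There exists a ${}^2\mathrm{H}(m,n;n,m)$ (an $m\times n$ $2$-fold Heffter array with no empty cells) if and only if $mn\not\equiv 1\pmod 4$ and $m,n$ are not both equal to $2$.
   Context: For positive integers $m,n,s,k,\lambda,t$ with $t$ dividing $\frac{2nk}{\lambda}$, let $v=\frac{2nk}{\lambda}+t$ and $J$ the subgroup of $\mathbb{Z}_v$ of order $t$. A ${}^\lambda\mathrm{H}_t(m,n;s,k)$ is an $m\times n$ partially filled array with entries in $\mathbb{Z}_v$ such that: (a) each row has exactly $s$ and each column exactly $k$ filled cells; (b) the multiset $\{\pm x: x$ an entry of a filled cell$\}$ contains each element of $\mathbb{Z}_v\setminus J$ exactly $\lambda$ times and no element of $J$; (c) every row and every column sums to $0$ in $\mathbb{Z}_v$. The subscript $t$ is omitted when $t=1$; thus ${}^2\mathrm{H}(m,n;n,m)$ is an $m\times n$ array over $\mathbb{Z}_{mn+1}$ with all cells filled. *)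

(* Defs.v *)
From mathcomp Require Import all_boot all_algebra.
Set Implicit Arguments. Unset Strict Implicit. Unset Printing Implicit Defensive.

(* v = 2nk/lambda + t ; elements of Z_v are represented by 'I_v,
   with group operations taken modulo v. *)
Definition hv (n k lambda t : nat) : nat := (2 * n * k) %/ lambda + t.

(* J = the subgroup of Z_v of order t (t | v), i.e. the multiples of v/t. *)
Definition inJ (v t x : nat) : bool := (v %/ t) %| x.

Definition pm_mult (v : nat) (x : 'I_v) (c : option 'I_v) : nat :=
  match c with
  | Some e => ((val e == val x) : nat) + (((v - val e) %% v == val x) : nat)
  | None => 0
  end.

Definition cell_val (v : nat) (c : option 'I_v) : nat :=
  match c with Some e => val e | None => 0 end.

(* A lambda-fold Heffter array  ^lambda H_t(m,n;s,k): None = empty cell. *)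
Definition is_heffter (m n s k lambda t : nat)
    (A : 'M[option 'I_(hv n k lambda t)]_(m, n)) : Prop :=
  let v := hv n k lambda t in
  [/\ ((t %| (2 * n * k) %/ lambda) /\ (lambda %| 2 * n * k)),
      (forall i, #|[set j | A i j != None]| = s),
      (forall j, #|[set i | A i j != None]| = k),
      (forall x : 'I_v,
          \sum_(i < m) \sum_(j < n) pm_mult x (A i j)
          = if inJ v t (val x) then 0 else lambda)
    & ((forall i, (\sum_(j < n) cell_val (A i j)) %% v = 0) /\
      (forall j, (\sum_(i < m) cell_val (A i j)) %% v = 0))].

(* Main.v *)
(**
Put v = mn + 1. If n = 2r is even, list the columns in pairs c, -c: it suffices to partition
{1, ..., mr} into r signed m-sets of sum 0 mod v. For m = 3 these come from (hooked) Skolem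
sequences, for m = 4, 5, 6 from nested pairs and short runs, and m grows by 4 by adding to each
set a quadruple a, -(a+1), -(a+2), a+3 of sum 0. Transposition reduces every even mn to this case.

If m, n are odd then, up to transposition, m = 3 and n = 1 modulo 4, and h = v/2, which has
order 2, must occur exactly once. A 3 x 3 or 3 x 5 corner absorbs h, h/2 and a few more elements, and is
extended by pairs of opposite rows (triples of sum 0) and of opposite columns (m-sets of sum 0).

Conversely, for mn = 1 mod 4 the number of odd entries is h, which is odd, although the sum of
all entries is even.
*)
Require Import Defs.
From mathcomp Require Import all_boot all_algebra.
From mathcomp Require Import zify ring.

Set Implicit Arguments. Unset Strict Implicit. Unset Printing Implicit Defensive.
Import GRing.Theory Num.Theory.

(** A partition of 1, ..., N into signed sets of integer sum 0 forces 1 + ... + N to be even, which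
    fails when N = mr is 1 or 2 modulo 4. The hook repairs this: mr + 1 is the opposite of mr modulo
    v, so it may stand in for mr, and it flips the parity. Block sums can thus be kept equal to 0 in
    the integers, and v matters only in the corners and in the final comparison of weights. For odd
    sides the corner entries sit at prescribed values that break up the interval 1, ..., h - 1.
    Nested pairs supply the triples, and quadruples made of two pairs of consecutive numbers fill
    whatever lies between the nests. When m = 3 there are no quadruples to fill with; hence the
    separate 3 x 5 corner and triples sorted by residues modulo 3, which leave out one number
    only. *)

Local Notation "v %|z x" := (Posz v %| x%R)%Z (at level 70, no associativity).

(** * Integer arrays modulo v, compared through even weights *)

Lemma dvdz_opp v x : (v %|z - x) = (v %|z x).
Proof. exact: rpredN. Qed.

(** Such a weight sees neither the sign of an entry nor its representative modulo [v], so arrays may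
    be filled with arbitrary integers. *)
Definition even_weight (v : nat) (w : int -> nat) : Prop :=
  (forall x, w (- x)%R = w x) /\ (forall x y : int, v %|z x - y -> w x = w y).

(* [f] is an array over Z_v whose multiset of entries up to sign is that of [l];
   multisets are compared by summing all weights invariant under sign and period [v]. *)
Definition realizes (v m n : nat) (l : seq int) : Prop :=
  exists f : nat -> nat -> int,
    [/\ forall i, i < m -> v %|z \sum_(0 <= j < n) f i j,
        forall j, j < n -> v %|z \sum_(0 <= i < m) f i j
      & forall w, even_weight v w ->
          \sum_(0 <= i < m) \sum_(0 <= j < n) w (f i j) = \sum_(x <- l) w x].

(** In 1, ..., v - 1 the class of d up to sign is met twice, as d and v - d, except that an element
    of order 2 is met once; this is condition (b) for entries up to sign. *)
Definition realizable (m n : nat) : Prop :=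
  exists2 l, realizes (n * m + 1) m n l & forall w, even_weight (n * m + 1) w ->
    \sum_(x <- l) w x = \sum_(1 <= d < n * m + 1) w (Posz d).

(* [v = 0] asks for blocks whose sum is [0] in [int]. *)
Definition zero_blocks (v m : nat) (ss : seq (seq int)) : Prop :=
  forall c, c \in ss -> size c = m /\ v %|z \sum_(x <- c) x.

Lemma realizes_tr v m n l : realizes v m n l -> realizes v n m l.
Proof.
case=> f [fr fc fw]; exists (fun i j => f j i); split=> // w ew.
by rewrite exchange_big_nat fw.
Qed.

Lemma realizes_nil v m : realizes v m 0 [::].
Proof.
exists (fun _ _ => 0%R); split=> [i _|//|w _]; first by rewrite big_geq.
by rewrite big_nil big1 // => i _; rewrite big_geq.
Qed.

(** The new columns are [c] and its opposite: row sums do not change, and an even weight sees [c]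
    twice. *)
Lemma realizes_cons v m n l (c : seq int) : realizes v m n l ->
  size c = m -> v %|z \sum_(x <- c) x -> realizes v m n.+2 (l ++ c ++ c).
Proof.
case=> f [fr fc fw] sc dc.
have dn : v %|z \sum_(0 <= i < m) nth 0%R c i by rewrite -sc -(big_nth 0%R xpredT id).
exists (fun i j => if j < n then f i j else
                   if j == n then nth 0%R c i else (- nth 0%R c i)%R).
split=> [i im|j|w ew].
- rewrite !big_nat_recr //= ltnn eqxx ltnNge leqnSn /= -addrA.
  rewrite (_ : n.+1 == n = false); last by lia.
  rewrite subrr addr0 (eq_big_nat _ _ (F2 := fun j => f i j)) ?fr // => j /andP[_ ->] //.
- rewrite ltnS leq_eqVlt ltnS leq_eqVlt => /or3P[/eqP->|/eqP->|jn].
  + rewrite ltnNge leqnSn /= (_ : n.+1 == n = false); last by lia.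
    by rewrite sumrN dvdz_opp.
  + by rewrite ltnn eqxx.
  + by rewrite jn fc.
rewrite !big_cat /= -(fw w ew) [\sum_(x <- c) _](big_nth 0%R) sc -!big_split /=.
apply: eq_bigr => i _; rewrite !big_nat_recr //= ltnn eqxx ltnNge leqnSn /=.
rewrite (_ : n.+1 == n = false); last by lia.
rewrite ew.1 -addnA; congr (_ + _).
by apply: eq_big_nat => j /andP[_ ->].
Qed.

Lemma realizes_cols v m n l ss : realizes v m n l -> zero_blocks v m ss ->
  realizes v m (n + 2 * size ss) (l ++ flatten [seq c ++ c | c <- ss]).
Proof.
elim: ss n l => [|c ss IH] n l rl zb /=; first by rewrite addn0 cats0.
have [sc dc] := zb c (mem_head _ _).
rewrite (_ : n + 2 * _ = n.+2 + 2 * size ss); last by lia.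
rewrite catA; apply: IH; first exact: realizes_cons.
by move=> d dss; apply: zb; rewrite inE dss orbT.
Qed.


(** * From weights to Heffter arrays *)

Lemma residue_weight v (x : nat) : even_weight v
  (fun y => (v %|z y - x%:Z) + (v %|z y + x%:Z)).
Proof.
split=> [y|y z dyz].
  have -> : (- y - x%:Z = - (y + x%:Z))%R by ring.
  have -> : (- y + x%:Z = - (y - x%:Z))%R by ring.
  by rewrite !dvdz_opp addnC.
have E u : (v %|z y + u) = (v %|z z + u).
  by rewrite (_ : (y + u = (y - z) + (z + u))%R) 1?rpredDl //; ring.
by rewrite !E.
Qed.

Lemma sum_eqn_interval a b x : \sum_(a <= d < b) (d == x : nat) = (a <= x < b).
Proof.
rewrite -big_mkcond /= sum1_count -mem_index_iota.
by rewrite -/(count_mem x (index_iota a b)) count_uniq_mem ?iota_uniq.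
Qed.

Lemma dvdz_small v (y : int) : `|y|%N < v -> (v %|z y) = (y == 0%R).
Proof.
move=> yv; apply/idP/eqP => [|->]; last exact: dvdz0.
by rewrite dvdzE /= => /dvdn_leq; lia.
Qed.

Lemma dvdz_diff_eq v (e x : nat) : e < v -> x < v -> (v %|z e%:Z - x%:Z) = (e == x).
Proof. by move=> ev xv; rewrite dvdz_small; lia. Qed.

Lemma dvdz_sum_eq v (e x : nat) : 0 < e < v -> x < v ->
  (v %|z e%:Z + x%:Z) = (v - e == x).
Proof.
move=> ev xv; rewrite (_ : (e%:Z + x%:Z = Posz v + (x%:Z - (v - e)%N%:Z))%R); last by lia.
by rewrite rpredDl ?dvdzz // dvdz_diff_eq 1?eq_sym; lia.
Qed.

(** For 0 < x the hits are d = x and d = v - x; if 2x = v this is a single d counted by both terms.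
    For x = 0 there is no hit, as the range omits 0 and v. *)
Lemma residue_weight_total v (x : nat) : x < v ->
  \sum_(1 <= d < v) ((v %|z d%:Z - x%:Z) + (v %|z d%:Z + x%:Z)) = if x == 0 then 0 else 2.
Proof.
move=> xv.
rewrite big_split /=.
rewrite (eq_big_nat _ _ (F2 := fun d => (d == x : nat))); last first.
  by move=> d /andP[_ dv]; rewrite dvdz_diff_eq.
rewrite sum_eqn_interval.
rewrite (eq_big_nat _ _ (F2 := fun d => (d == v - x : nat))); last first.
  by move=> d d1; rewrite dvdz_sum_eq //; congr nat_of_bool; lia.
by rewrite sum_eqn_interval; case: eqP; lia.
Qed.

Lemma absz_mod_lt v (y : int) : 0 < v -> `|(y %% Posz v)%Z|%N < v.
Proof.
move=> v0; have vz : Posz v != 0%R by lia.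
by have := modz_ge0 y vz; have := @ltz_mod y (Posz v) vz; lia.
Qed.

Lemma absz_mod_dvd v (y : int) : 0 < v -> v %|z y - Posz `|(y %% Posz v)%Z|%N.
Proof.
move=> v0; have vz : Posz v != 0%R by lia.
by rewrite gez0_abs ?modz_ge0 // {1}(divz_eq y (Posz v)) addrK dvdz_mull.
Qed.

Lemma realizable_heffter m n : realizable m n ->
  exists A : 'M[option 'I_(hv n m 2 1)]_(m, n), @is_heffter m n n m 2 1 A.
Proof.
case=> l [f [fr fc fw]] lw.
have vE : hv n m 2 1 = n * m + 1 by rewrite /hv -mulnA mulKn.
have v0 : 0 < hv n m 2 1 by rewrite vE addn1.
rewrite -{}vE in fr fc fw lw.
have lt_f i j := absz_mod_lt (f i j) v0.
exists (\matrix_(i < m, j < n) Some (Ordinal (lt_f i j)))%R; split.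
- split; first exact: dvd1n.
  by rewrite -mulnA dvdn_mulr.
- by move=> i; rewrite (_ : [set j | _] = setT) ?cardsT ?card_ord //; apply/setP=> j; rewrite !inE mxE.
- by move=> i; rewrite (_ : [set j | _] = setT) ?cardsT ?card_ord //; apply/setP=> j; rewrite !inE mxE.
- move=> x; rewrite /inJ divn1.
  have xv := ltn_ord x.
  have := residue_weight_total xv.
  (* Tested with the residue weight of [x], equality of multisets becomes the count that [pm_mult]
     performs. *)
  rewrite -(lw _ (residue_weight _ _)) -(fw _ (residue_weight _ _)) !big_mkord.
  rewrite /dvdn modn_small // => <-.
  apply: eq_bigr => i _; rewrite big_mkord; apply: eq_bigr => j _; rewrite mxE /=.
  have := lt_f i j; have := absz_mod_dvd (f i j) v0.
  move: (nat_of_ord x) xv => {}x; set v := hv _ _ _ _; set e := `|_|%N => xv fe ev.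
  rewrite !((residue_weight v x).2 _ _ fe) dvdz_diff_eq //; congr (_ + nat_of_bool _).
  (* The residue 0 is apart because v - 0 is not reduced modulo v. *)
  case: (posnP e) => [->|e0]; last by rewrite dvdz_sum_eq ?modn_small //; lia.
  by rewrite subn0 modnn add0r dvdz_small //; lia.
have red I (r : seq I) (F : I -> int) (v : nat) : 0 < v -> v %|z \sum_(i <- r) F i ->
    (\sum_(i <- r) `|(F i %% Posz v)%Z|%N) %% v = 0.
  move=> vpos d; apply/eqP; rewrite -[_ == 0]/(_ %| _)%N -[_ %| _]/(Posz v %| Posz _)%Z.
  rewrite (big_morph Posz PoszD (erefl (Posz 0))) -(rpredBl _ d) -sumrB.
  by apply: rpred_sum => i _; apply: absz_mod_dvd.
split=> [i|j].
  rewrite (eq_bigr (fun j : 'I_n => `|(f i j %% Posz (hv n m 2 1))%Z|%N)); last by move=> j _; rewrite mxE.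
  by apply: red v0 _; have := fr i (ltn_ord i); rewrite big_mkord.
rewrite (eq_bigr (fun i : 'I_m => `|(f i j %% Posz (hv n m 2 1))%Z|%N)); last by move=> i _; rewrite mxE.
by apply: red v0 _; have := fc j (ltn_ord j); rewrite big_mkord.
Qed.

(** * Signed blocks of integers and sums over intervals *)

Definition wsum (w : nat -> nat) (ss : seq (seq int)) : nat :=
  \sum_(c <- ss) \sum_(x <- c) w `|x|%N.

Definition isum (w : nat -> nat) (a b : nat) : nat := \sum_(a <= d < b) w d.

Lemma isum_split w c a b : a <= c <= b -> isum w a b = isum w a c + isum w c b.
Proof. by move=> /andP[ac cb]; rewrite /isum (@big_cat_nat _ _ _ c). Qed.

Lemma isum1 w a b : b = a.+1 -> isum w a b = w a.
Proof. by move=> ->; rewrite /isum big_nat1. Qed.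

Lemma isum0 w a b : b <= a -> isum w a b = 0.
Proof. by move=> ba; rewrite /isum big_geq. Qed.

Lemma isum_recl w a b : a < b -> isum w a b = w a + isum w a.+1 b.
Proof. by move=> ab; rewrite (@isum_split w a.+1) ?[isum w a a.+1]isum1 //; lia. Qed.

Lemma isum_up w a n : \sum_(0 <= i < n) w (a + i) = isum w a (a + n).
Proof. by rewrite /isum -{2}[a]add0n big_addn addKn; apply: eq_bigr => i _; rewrite addnC. Qed.

Lemma isum_down w a n : n <= a -> \sum_(0 <= i < n) w (a - 1 - i) = isum w (a - n) a.
Proof.
elim: n => [|n IH] na; first by rewrite big_geq // subn0 isum0.
rewrite big_nat_recr //= IH; last by lia.
rewrite (@isum_split w (a - n) (a - n.+1)); last by lia.
by rewrite [isum w (a - n.+1) _]isum1 1?addnC; first (congr (w _ + _)); lia.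
Qed.

Lemma wsum_cat w ss tt : wsum w (ss ++ tt) = wsum w ss + wsum w tt.
Proof. exact: big_cat. Qed.

Lemma wsum_cons w c ss : wsum w (c :: ss) = \sum_(x <- c) w `|x|%N + wsum w ss.
Proof. exact: big_cons. Qed.

Lemma wsum_map w (F : nat -> seq int) n :
  wsum w [seq F i | i <- index_iota 0 n] = \sum_(0 <= i < n) \sum_(x <- F i) w `|x|%N.
Proof. exact: big_map. Qed.

Lemma wsum_flatten w ss : \sum_(x <- flatten ss) w `|x|%N = wsum w ss.
Proof. exact: big_flatten. Qed.

Lemma zero_blocks_nil v m : zero_blocks v m [::]. Proof. by []. Qed.

Lemma zero_blocks_cat v m ss tt :
  zero_blocks v m ss -> zero_blocks v m tt -> zero_blocks v m (ss ++ tt).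
Proof. by move=> zs zt c; rewrite mem_cat => /orP[/zs|/zt]. Qed.

Lemma zero_blocks_cons v m (c : seq int) ss : size c = m -> v %|z \sum_(x <- c) x ->
  zero_blocks v m ss -> zero_blocks v m (c :: ss).
Proof. by move=> sc dc zs d; rewrite inE => /orP[/eqP->|/zs]. Qed.

Lemma zero_blocks_map v m (F : nat -> seq int) n :
  (forall i, i < n -> size (F i) = m /\ v %|z \sum_(x <- F i) x) ->
  zero_blocks v m [seq F i | i <- index_iota 0 n].
Proof. by move=> zF c /mapP[i]; rewrite mem_index_iota => /zF ? ->. Qed.

Lemma zero_blocks_mod v m ss : zero_blocks 0 m ss -> zero_blocks v m ss.
Proof. by move=> z c /z[-> /[!dvd0z] /eqP->]; rewrite dvdz0. Qed.

Lemma blocks_zip v m m' ss tt : size ss = size tt ->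
  zero_blocks v m ss -> zero_blocks v m' tt ->
  exists uu, [/\ zero_blocks v (m + m') uu, size uu = size ss
    & forall w, wsum w uu = wsum w ss + wsum w tt].
Proof.
elim: ss tt => [|c ss IH] [|d tt] //=.
  by move=> _ _ _; exists [::]; split=> // w; rewrite /wsum big_nil.
move=> [st] zs zt.
have zs' : zero_blocks v m ss by move=> e ess; apply: zs; rewrite inE ess orbT.
have zt' : zero_blocks v m' tt by move=> e ett; apply: zt; rewrite inE ett orbT.
have [uu [zu su wu]] := IH tt st zs' zt'.
have [sc dc] := zs c (mem_head _ _); have [sd dd] := zt d (mem_head _ _).
exists ((c ++ d) :: uu); split=> [||w]; last by rewrite !wsum_cons wu big_cat /= addnACA.
  by apply: zero_blocks_cons => //; rewrite ?size_cat ?sc ?sd // big_cat rpredD.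
by rewrite /= su.
Qed.

(** Each of the [j] rounds spends [size ss] quadruples, one per block. *)
Lemma blocks_extend v m j ss qs : size qs = j * size ss ->
  zero_blocks v m ss -> zero_blocks v 4 qs ->
  exists uu, [/\ zero_blocks v (m + 4 * j) uu, size uu = size ss
    & forall w, wsum w uu = wsum w ss + wsum w qs].
Proof.
elim: j m ss qs => [|j IH] m ss qs sq zs zq.
  exists ss; rewrite muln0 addn0; split=> // w; rewrite (size0nil sq) /wsum big_nil.
  by rewrite addn0.
have st : size (take (size ss) qs) = size ss by rewrite size_takel // sq mulSn leq_addr.
have zt : zero_blocks v 4 (take (size ss) qs) by move=> c /mem_take; apply: zq.
have zd : zero_blocks v 4 (drop (size ss) qs) by move=> c /mem_drop; apply: zq.
have [u [zu su wu]] := blocks_zip (esym st) zs zt.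
have sd : size (drop (size ss) qs) = j * size u by rewrite size_drop sq su mulSn addKn.
have [uu [zuu suu wuu]] := IH _ _ _ sd zu zd.
exists uu; split=> [||w]; rewrite ?suu //; first by rewrite mulnS addnA.
by rewrite wuu wu -addnA -wsum_cat cat_take_drop.
Qed.

(** * Lengthening blocks by quadruples, without and with a hook *)

Definition run4 (a n : nat) : seq (seq int) :=
  [seq [:: Posz (a + 4 * i); - Posz (a + 4 * i + 1);
          - Posz (a + 4 * i + 2); Posz (a + 4 * i + 3)]%R | i <- index_iota 0 n].

Lemma size_run4 a n : size (run4 a n) = n.
Proof. by rewrite size_map size_iota subn0. Qed.

Lemma zero_blocks_run4 a n : zero_blocks 0 4 (run4 a n).
Proof. by apply: zero_blocks_map => i _; rewrite !big_cons big_nil dvd0z; split=> //; lia. Qed.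

Lemma wsum_run4 w a n : wsum w (run4 a n) = isum w a (a + 4 * n).
Proof.
rewrite wsum_map; elim: n => [|n IH]; first by rewrite big_geq // isum0 ?addn0.
rewrite big_nat_recr //= IH !big_cons big_nil !abszN !absz_nat addn0.
rewrite [RHS](isum_split w (c := a + 4 * n)); last by lia.
have -> : a + 4 * n.+1 = (a + 4 * n).+4 by lia.
move: (a + 4 * n) => b; rewrite [isum w b _]/isum /index_iota (_ : b.+4 - b = 4); last by lia.
by rewrite /= !big_cons big_nil addn1 addn2 addn3 addn0.
Qed.

(* A zero-sum partition of [1 .. m * r] into [r] signed [m]-lists; [hooked] replaces
   [m * r] by [m * r + 1], which is congruent to [- (m * r)] modulo [2 * m * r + 1]. *)
Definition tight (m r : nat) : Prop :=
  exists ss, [/\ zero_blocks 0 m ss, size ss = r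
    & forall w, wsum w ss = isum w 1 (m * r).+1].

Definition hooked (m r : nat) : Prop :=
  exists ss, [/\ zero_blocks 0 m ss, size ss = r
    & forall w, wsum w ss = isum w 1 (m * r) + w (m * r).+1].

Lemma tight_extend m r j : tight m r -> tight (m + 4 * j) r.
Proof.
case=> ss [zs sr ws].
have [||uu [zu su wu]] := @blocks_extend 0 m j ss (run4 (m * r).+1 (j * r)) _ zs.
- by rewrite size_run4 sr.
- exact: zero_blocks_run4.
exists uu; split; rewrite ?su // => w.
rewrite wu ws wsum_run4 -isum_split; last by lia.
by congr (isum w 1 _); lia.
Qed.

(* The hook is moved by the quadruple [a], [a + 2], [N - 1], [N + 1], two pairs with difference 2. *)
Lemma hooked_extend m r j : 0 < m -> 0 < r -> hooked m r -> hooked (m + 4 * j) r.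
Proof.
case: j => [|j]; first by rewrite muln0 addn0.
move=> m0 r0 [ss [zs sr ws]].
pose a := m * r; pose N := (m + 4 * j.+1) * r.
have jr : 0 < j.+1 * r by rewrite muln_gt0.
have NE : N = a + 4 * (j.+1 * r) by rewrite /N mulnDl mulnA.
have [||uu [zu su wu]] := @blocks_extend 0 m j.+1 ss
    ([:: Posz a; - Posz (a + 2); - Posz (N - 1); Posz N.+1]%R :: run4 (a + 3) (j.+1 * r - 1)) _ zs.
- by rewrite /= size_run4 sr; lia.
- apply: zero_blocks_cons; last exact: zero_blocks_run4; first by [].
  by rewrite !big_cons big_nil dvd0z; lia.
exists uu; split; rewrite ?su // => w.
rewrite wu ws wsum_cons wsum_run4 !big_cons big_nil !abszN !absz_nat -/a -/N.
have a0 : 0 < a by rewrite muln_gt0 m0.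
rewrite (@isum_split w a 1 N); last by lia.
rewrite (@isum_split w a.+1 a N) ?[isum w a a.+1]isum1; try lia.
rewrite (@isum_split w a.+2 a.+1 N) ?[isum w a.+1 a.+2]isum1; try lia.
rewrite (@isum_split w a.+3 a.+2 N) ?[isum w a.+2 a.+3]isum1; try lia.
rewrite (@isum_split w (N - 1) a.+3 N) ?[isum w (N - 1) N]isum1; try lia.
have -> : a + 3 + 4 * (j.+1 * r - 1) = N - 1 by lia.
by rewrite addn2 addn3; lia.
Qed.

(** * Cutting intervals at given points and by parity *)

Lemma isum_cuts w a l : path leq a l ->
  isum w a (last a l) = sumn (pairmap (isum w) a l).
Proof.
elim: l a => [|b l IH] a /=; first by rewrite isum0.
move=> /andP[ab pl]; rewrite -IH // -isum_split // ab /=.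
elim: l b pl {IH ab} => //= c l IH b /andP[bc /IH]; exact: leq_trans.
Qed.

Lemma isumS w a : isum w a a.+1 = w a. Proof. exact: isum1. Qed.

Lemma isum_shift w k a b : isum (fun x => w (k + x)) a b = isum w (k + a) (k + b).
Proof.
rewrite /isum addnC (addnC k b) big_addn addnK; apply: eq_bigr => i _.
by rewrite addnC.
Qed.

Lemma isum_parity w n :
  isum w 1 (2 * n).+1 = isum (fun x => w (2 * x).+1) 0 n + isum (fun x => w (2 * x)) 1 n.+1.
Proof.
elim: n => [|n IH]; first by rewrite !isum0.
rewrite (@isum_split w (2 * n).+1); last by lia.
rewrite IH (@isum_split _ n 0 n.+1); last by lia.
rewrite (@isum_split _ n.+1 1 n.+2); last by lia.
rewrite !isumS (@isum_recl w (2 * n).+1); last by lia.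
have -> : 2 * n.+1 = (2 * n).+2 by lia.
by rewrite isumS; lia.
Qed.

Lemma isum_parity_odd w n :
  isum w 1 (2 * n).+2 = isum (fun x => w (2 * x).+1) 0 n.+1 + isum (fun x => w (2 * x)) 1 n.+1.
Proof.
rewrite (@isum_split w (2 * n).+1 1 (2 * n).+2); last by lia.
rewrite isum_parity (@isum_split _ n 0 n.+1); last by lia.
by rewrite !isumS; lia.
Qed.

(** * Blocks of sizes 4 and 6 *)

Lemma tight4 r : tight 4 r.
Proof.
exists (run4 1 r); split=> [||w]; [exact: zero_blocks_run4|exact: size_run4|].
by rewrite wsum_run4 add1n.
Qed.

(** Twelve consecutive integers are split into two halves of signed sum 0. The left half takes the
    offsets 1, ..., 5 and 7, so a left half on its own ends in a hook; an odd number of blocks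
    finishes with it. *)
Definition sextuple_l i : seq int := [:: Posz (12 * i + 1); - Posz (12 * i + 2); Posz (12 * i + 3);
  - Posz (12 * i + 4); - Posz (12 * i + 5); Posz (12 * i + 7)]%R.
Definition sextuple_r i : seq int := [:: Posz (12 * i + 6); - Posz (12 * i + 8); - Posz (12 * i + 9);
  Posz (12 * i + 10); - Posz (12 * i + 11); Posz (12 * i + 12)]%R.

Lemma wsum_sextuples w n : wsum w ([seq sextuple_l i | i <- index_iota 0 n] ++
    [seq sextuple_r i | i <- index_iota 0 n]) = isum w 1 (12 * n).+1.
Proof.
rewrite wsum_cat !wsum_map -big_split /=; elim: n => [|n IH]; first by rewrite big_geq // isum0.
rewrite big_nat_recr //= IH !big_cons big_nil !abszN !absz_nat.
rewrite [RHS](@isum_split w (12 * n).+1); last by lia.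
rewrite [isum w (12 * n).+1 _]/isum /index_iota (_ : _ - _ = 12); last by lia.
rewrite /= !big_cons big_nil !addnS !addn0; lia.
Qed.

Lemma zero_blocks_sextuples n n' : zero_blocks 0 6 ([seq sextuple_l i | i <- index_iota 0 n] ++
    [seq sextuple_r i | i <- index_iota 0 n']).
Proof.
by apply: zero_blocks_cat; apply: zero_blocks_map => i _;
  rewrite !big_cons big_nil dvd0z; split=> //; lia.
Qed.

Lemma tight6 n : tight 6 (2 * n).
Proof.
exists ([seq sextuple_l i | i <- index_iota 0 n] ++ [seq sextuple_r i | i <- index_iota 0 n]).
split=> [||w]; first exact: zero_blocks_sextuples.
  by rewrite size_cat !size_map !size_iota; lia.
by rewrite wsum_sextuples; congr (isum w 1 _.+1); lia.
Qed.

Lemma hooked6 n : hooked 6 (2 * n).+1.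
Proof.
exists ([seq sextuple_l i | i <- index_iota 0 n.+1] ++ [seq sextuple_r i | i <- index_iota 0 n]).
split=> [||w]; first exact: zero_blocks_sextuples.
  by rewrite size_cat !size_map !size_iota; lia.
rewrite wsum_cat wsum_map big_nat_recr //= -wsum_map addnAC -wsum_cat wsum_sextuples.
rewrite !big_cons big_nil !abszN !absz_nat addn0.
rewrite (@isum_split w (12 * n).+1 1 (6 * (2 * n).+1)); last by lia.
rewrite [isum w (12 * n).+1 _]/isum /index_iota (_ : _ - _ = 5); last by lia.
rewrite /= !big_cons big_nil (_ : 6 * _ = 12 * n + 6); last by lia.
rewrite !addnS !addn0; lia.
Qed.

(** * Blocks of size 3 from Skolem sequences *)

Definition differences_cover (r : nat) (ps : seq (nat * nat)) : Prop :=
  [/\ all (fun p => p.1 <= p.2) ps, size ps = r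
    & forall w, \sum_(p <- ps) w (p.2 - p.1) = isum w 1 r.+1].

(** A pair p <= q of difference d gives d + (r + p) - (r + q) = 0; the shift by r places the pairs
    above the differences 1, ..., r. *)
Lemma skolem_blocks r ps : differences_cover r ps ->
  exists ss, [/\ zero_blocks 0 3 ss, size ss = r
    & forall w, wsum w ss = isum w 1 r.+1 + \sum_(p <- ps) (w (r + p.1) + w (r + p.2))].
Proof.
case=> le_ps sr dw.
exists [seq [:: Posz (p.2 - p.1); Posz (r + p.1); - Posz (r + p.2)]%R | p <- ps]; split.
- move=> c /mapP[p /(allP le_ps) pl ->]; split=> //.
  by rewrite !big_cons big_nil dvd0z; lia.
- by rewrite size_map.
move=> w; rewrite /wsum big_map -dw -big_split; apply: eq_bigr => p _.
by rewrite !big_cons big_nil !abszN !absz_nat addn0.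
Qed.

Lemma skolem_tight r ps : differences_cover r ps ->
  (forall w, \sum_(p <- ps) (w p.1 + w p.2) = isum w 1 (2 * r).+1) -> tight 3 r.
Proof.
move=> /skolem_blocks[ss [zs sr ws]] pw; exists ss; split=> // w.
rewrite ws (pw (fun x => w (r + x))) isum_shift addn1 -(@isum_split w r.+1); last by lia.
by congr (isum w 1 _); lia.
Qed.

Lemma skolem_hooked r ps : 0 < r -> differences_cover r ps ->
  (forall w, \sum_(p <- ps) (w p.1 + w p.2) = isum w 1 (2 * r) + w (2 * r).+1) -> hooked 3 r.
Proof.
move=> r0 /skolem_blocks[ss [zs sr ws]] pw; exists ss; split=> // w.
rewrite ws (pw (fun x => w (r + x))) isum_shift addnA addn1 -(@isum_split w r.+1); last by lia.
by congr (isum w 1 _ + w _); lia.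
Qed.

Lemma sum_desc (f G : nat -> nat) b c n : c = b + n ->
  (forall i, i < n -> G i = f (c - 1 - i)) -> \sum_(0 <= i < n) G i = isum f b c.
Proof.
move=> -> GE; rewrite (eq_big_nat _ _ (F2 := fun i => f (b + n - 1 - i))) => [|i /andP[_ /GE]//].
by rewrite isum_down ?addnK ?leq_addl.
Qed.

Lemma sum_asc (f G : nat -> nat) b c n : c = b + n ->
  (forall i, i < n -> G i = f (b + i)) -> \sum_(0 <= i < n) G i = isum f b c.
Proof.
by move=> -> GE; rewrite (eq_big_nat _ _ (F2 := fun i => f (b + i))) ?isum_up // => i /andP[_ /GE].
Qed.

Lemma isum_at (f : nat -> nat) x b c : c = b.+1 -> x = f b -> x = isum f b c.
Proof. by move=> -> ->; rewrite isumS. Qed.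

Definition pair_seg (A B : nat -> nat) n := [seq (A i, B i) | i <- index_iota 0 n].

Lemma pair_seg_diff A B n (w : nat -> nat) :
  \sum_(p <- pair_seg A B n) w (p.2 - p.1) = \sum_(0 <= i < n) w (B i - A i).
Proof. exact: big_map. Qed.

Lemma pair_seg_ends A B n (w : nat -> nat) :
  \sum_(p <- pair_seg A B n) (w p.1 + w p.2) =
  \sum_(0 <= i < n) w (A i) + \sum_(0 <= i < n) w (B i).
Proof. by rewrite big_map big_split. Qed.

Lemma pair_seg_le A B n : (forall i, i < n -> A i <= B i) ->
  all (fun p => p.1 <= p.2) (pair_seg A B n).
Proof. by move=> AB; apply/allP => p /mapP[i]; rewrite mem_index_iota => /AB ? ->. Qed.

Lemma size_pair_seg A B n : size (pair_seg A B n) = n.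
Proof. by rewrite size_map size_iota subn0. Qed.

Ltac term_eq :=
  first [done | lia | let i := fresh "i" in intro i; intros; congr (_ _); lia | congr (_ _); lia].

(* The next four lemmas use the classical Skolem and hooked Skolem sequences. *)
Lemma skolem_mod0 s : 1 < s -> tight 3 (4 * s).
Proof.
move=> s1; apply: (@skolem_tight _
  (pair_seg (fun i => 4 * s + i) (fun i => 8 * s - i) (2 * s) ++
   pair_seg (fun i => 1 + i) (fun i => 4 * s - 2 - i) (s - 2) ++
   pair_seg (fun i => s + 2 + i) (fun i => 3 * s - 1 - i) (s - 2) ++
   [:: (s - 1, 3 * s); (s, s + 1); (2 * s, 4 * s - 1); (2 * s + 1, 6 * s)])).
split=> [||w].
- by rewrite !all_cat !pair_seg_le /=; lia.
- by rewrite !size_cat !size_pair_seg /=; lia.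
(* Along a segment the difference drops by 2, so odd and even differences are tallied separately;
   the four isolated pairs supply the odd differences that the segments skip. *)
- pose wo x := w (2 * x).+1; pose we x := w (2 * x).
  rewrite !big_cat /= !pair_seg_diff !big_cons big_nil /=.
  rewrite (@sum_desc we _ 1 (2 * s).+1); [|term_eq ..].
  rewrite (@sum_desc wo _ s.+1 (2 * s - 1)); [|term_eq ..].
  rewrite (@sum_desc wo _ 1 (s - 1)); [|term_eq ..].
  rewrite (@isum_at wo (w (3 * s - (s - 1))) s s.+1); [|term_eq ..].
  rewrite (@isum_at wo (w (s + 1 - s)) 0 1); [|term_eq ..].
  rewrite (@isum_at wo (w (4 * s - 1 - 2 * s)) (s - 1) s); [|term_eq ..].
  rewrite (@isum_at wo (w (6 * s - (2 * s + 1))) (2 * s - 1) (2 * s)); [|term_eq ..].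
  have -> : 4 * s = 2 * (2 * s) by lia.
  have -> : isum w 1 (2 * (2 * s)).+1 = isum wo 0 (2 * s) + isum we 1 (2 * s).+1.
    exact: isum_parity.
  have := @isum_cuts wo 0 [:: 1; s - 1; s; s.+1; 2 * s - 1; 2 * s].
  by rewrite /= => ->; lia.
move=> w; rewrite !big_cat /= !pair_seg_ends !big_cons big_nil /=.
rewrite (@sum_asc w _ (4 * s) (6 * s)); [|term_eq ..].
rewrite (@sum_desc w _ (6 * s).+1 (8 * s).+1); [|term_eq ..].
rewrite (@sum_asc w _ 1 (s - 1)); [|term_eq ..].
rewrite (@sum_desc w _ (3 * s).+1 (4 * s - 1)); [|term_eq ..].
rewrite (@sum_asc w _ (s + 2) (2 * s)); [|term_eq ..].
rewrite (@sum_desc w _ (2 * s + 2) (3 * s)); [|term_eq ..].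
have := @isum_cuts w 1 [:: s - 1; s; s + 1; s + 2; 2 * s; 2 * s + 1; 2 * s + 2;
  3 * s; (3 * s).+1; 4 * s - 1; 4 * s; 6 * s; (6 * s).+1; (8 * s).+1].
rewrite (_ : 2 * (4 * s) = 8 * s) /=; last by lia.
rewrite (@isum1 w (s - 1) s) ?(@isum1 w s (s + 1)) ?(@isum1 w (s + 1) (s + 2)); try lia.
rewrite (@isum1 w (2 * s) (2 * s + 1)) ?(@isum1 w (2 * s + 1) (2 * s + 2)); try lia.
rewrite (@isum1 w (3 * s) (3 * s).+1) ?(@isum1 w (4 * s - 1) (4 * s)); try lia.
by rewrite isumS => ->; lia.
Qed.

Lemma skolem_mod1 s : 1 < s -> tight 3 (4 * s + 1).
Proof.
move=> s1; apply: (@skolem_tight _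
  (pair_seg (fun i => 4 * s + 2 + i) (fun i => 8 * s + 2 - i) (2 * s) ++
   pair_seg (fun i => 1 + i) (fun i => 4 * s - i) s ++
   pair_seg (fun i => s + 3 + i) (fun i => 3 * s - i) (s - 2) ++
   [:: (s + 1, s + 2); (2 * s + 1, 6 * s + 2); (2 * s + 2, 4 * s + 1)])).
split=> [||w].
- by rewrite !all_cat !pair_seg_le /=; lia.
- by rewrite !size_cat !size_pair_seg /=; lia.
- pose wo x := w (2 * x).+1; pose we x := w (2 * x).
  rewrite !big_cat /= !pair_seg_diff !big_cons big_nil /=.
  rewrite (@sum_desc we _ (1) ((2 * s).+1)); [|term_eq ..].
  rewrite (@sum_desc wo _ (s) (2 * s)); [|term_eq ..].
  rewrite (@sum_desc wo _ (1) (s - 1)); [|term_eq ..].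
  rewrite (@isum_at wo (w (s + 2 - (s + 1))) (0) (1)); [|term_eq ..].
  rewrite (@isum_at wo (w (6 * s + 2 - (2 * s + 1))) (2 * s) ((2 * s).+1)); [|term_eq ..].
  rewrite (@isum_at wo (w (4 * s + 1 - (2 * s + 2))) (s - 1) (s)); [|term_eq ..].
  have -> : isum w 1 (4 * s + 1).+1 = isum wo 0 (2 * s).+1 + isum we 1 (2 * s).+1.
    by rewrite -isum_parity_odd; congr (isum w 1 _); lia.
  have := @isum_cuts wo 0 [:: 1; s - 1; s; 2 * s; (2 * s).+1].
  by rewrite /= => ->; lia.
move=> w; rewrite !big_cat /= !pair_seg_ends !big_cons big_nil /=.
rewrite (@sum_asc w _ (4 * s + 2) (6 * s + 2)); [|term_eq ..].
rewrite (@sum_desc w _ (6 * s + 3) (8 * s + 3)); [|term_eq ..].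
rewrite (@sum_asc w _ (1) (s + 1)); [|term_eq ..].
rewrite (@sum_desc w _ (3 * s + 1) (4 * s + 1)); [|term_eq ..].
rewrite (@sum_asc w _ (s + 3) (2 * s + 1)); [|term_eq ..].
rewrite (@sum_desc w _ (2 * s + 3) (3 * s + 1)); [|term_eq ..].
have := @isum_cuts w 1 [:: s + 1; s + 2; s + 3; 2 * s + 1; 2 * s + 2; 2 * s + 3; 3 * s + 1;
  4 * s + 1; 4 * s + 2; 6 * s + 2; 6 * s + 3; 8 * s + 3].
rewrite (_ : (2 * (4 * s + 1)).+1 = 8 * s + 3) /=; last by lia.
rewrite (@isum1 w (s + 1) (s + 2)); last by lia.
rewrite (@isum1 w (s + 2) (s + 3)); last by lia.
rewrite (@isum1 w (2 * s + 1) (2 * s + 2)); last by lia.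
rewrite (@isum1 w (2 * s + 2) (2 * s + 3)); last by lia.
rewrite (@isum1 w (4 * s + 1) (4 * s + 2)); last by lia.
rewrite (@isum1 w (6 * s + 2) (6 * s + 3)); last by lia.
by move=> ->; lia.
Qed.

Lemma hooked_skolem_mod2 s : 0 < s -> hooked 3 (4 * s + 2).
Proof.
move=> s1; apply: (@skolem_hooked _
  (pair_seg (fun i => 1 + i) (fun i => 4 * s + 1 - i) (2 * s) ++
   pair_seg (fun i => 4 * s + 4 + i) (fun i => 8 * s + 3 - i) (s - 1) ++
   pair_seg (fun i => 5 * s + 3 + i) (fun i => 7 * s + 2 - i) (s - 1) ++
   [:: (2 * s + 1, 6 * s + 2); (4 * s + 2, 6 * s + 3); (4 * s + 3, 8 * s + 5);
       (7 * s + 3, 7 * s + 4)]));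
  first by lia.
split=> [||w].
- by rewrite !all_cat !pair_seg_le /=; lia.
- by rewrite !size_cat !size_pair_seg /=; lia.
- pose wo x := w (2 * x).+1; pose we x := w (2 * x).
  rewrite !big_cat /= !pair_seg_diff !big_cons big_nil /=.
  rewrite (@sum_desc we _ (1) ((2 * s).+1)); [|term_eq ..].
  rewrite (@sum_desc wo _ (s + 1) (2 * s)); [|term_eq ..].
  rewrite (@sum_desc wo _ (1) (s)); [|term_eq ..].
  rewrite (@isum_at wo (w (6 * s + 2 - (2 * s + 1))) (2 * s) ((2 * s).+1)); [|term_eq ..].
  rewrite (@isum_at wo (w (6 * s + 3 - (4 * s + 2))) (s) (s + 1)); [|term_eq ..].
  rewrite (@isum_at we (w (8 * s + 5 - (4 * s + 3))) ((2 * s).+1) ((2 * s).+2)); [|term_eq ..].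
  rewrite (@isum_at wo (w (7 * s + 4 - (7 * s + 3))) (0) (1)); [|term_eq ..].
  have -> : isum w 1 (4 * s + 2).+1 = isum wo 0 (2 * s).+1 + isum we 1 (2 * s).+2.
    by rewrite -isum_parity; congr (isum w 1 _.+1); lia.
  have := @isum_cuts wo 0 [:: 1; s; s + 1; 2 * s; (2 * s).+1].
  have := @isum_cuts we 1 [:: (2 * s).+1; (2 * s).+2].
  rewrite /= => ->; last by lia.
  by move=> ->; lia.
move=> w; rewrite !big_cat /= !pair_seg_ends !big_cons big_nil /=.
rewrite (@sum_asc w _ (1) (2 * s + 1)); [|term_eq ..].
rewrite (@sum_desc w _ (2 * s + 2) (4 * s + 2)); [|term_eq ..].
rewrite (@sum_asc w _ (4 * s + 4) (5 * s + 3)); [|term_eq ..].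
rewrite (@sum_desc w _ (7 * s + 5) (8 * s + 4)); [|term_eq ..].
rewrite (@sum_asc w _ (5 * s + 3) (6 * s + 2)); [|term_eq ..].
rewrite (@sum_desc w _ (6 * s + 4) (7 * s + 3)); [|term_eq ..].
have := @isum_cuts w 1 [:: 2 * s + 1; 2 * s + 2; 4 * s + 2; 4 * s + 3; 4 * s + 4; 5 * s + 3;
  6 * s + 2; 6 * s + 3; 6 * s + 4; 7 * s + 3; 7 * s + 4; 7 * s + 5; 8 * s + 4].
have -> : (2 * (4 * s + 2)).+1 = 8 * s + 5 by lia.
rewrite (_ : 2 * (4 * s + 2) = 8 * s + 4) /=; last by lia.
rewrite (@isum1 w (2 * s + 1) (2 * s + 2)); last by lia.
rewrite (@isum1 w (4 * s + 2) (4 * s + 3)); last by lia.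
rewrite (@isum1 w (4 * s + 3) (4 * s + 4)); last by lia.
rewrite (@isum1 w (6 * s + 2) (6 * s + 3)); last by lia.
rewrite (@isum1 w (6 * s + 3) (6 * s + 4)); last by lia.
rewrite (@isum1 w (7 * s + 3) (7 * s + 4)); last by lia.
rewrite (@isum1 w (7 * s + 4) (7 * s + 5)); last by lia.
by move=> ->; lia.
Qed.

Lemma hooked_skolem_mod3 s : 1 < s -> hooked 3 (4 * s - 1).
Proof.
move=> s1; apply: (@skolem_hooked _
  (pair_seg (fun i => 4 * s + 1 + i) (fun i => 8 * s - 3 - i) (2 * s - 2) ++
   pair_seg (fun i => 1 + i) (fun i => 4 * s - 2 - i) (s - 2) ++
   pair_seg (fun i => s + 2 + i) (fun i => 3 * s - 1 - i) (s - 2) ++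
   [:: (s - 1, 3 * s); (s, s + 1); (2 * s, 4 * s - 1); (2 * s + 1, 6 * s - 1);
       (4 * s, 8 * s - 1)]));
  first by lia.
split=> [||w].
- by rewrite !all_cat !pair_seg_le /=; lia.
- by rewrite !size_cat !size_pair_seg /=; lia.
- pose wo x := w (2 * x).+1; pose we x := w (2 * x).
  rewrite !big_cat /= !pair_seg_diff !big_cons big_nil /=.
  rewrite (@sum_desc we _ (1) (2 * s - 1)); [|term_eq ..].
  rewrite (@sum_desc wo _ (s + 1) (2 * s - 1)); [|term_eq ..].
  rewrite (@sum_desc wo _ (1) (s - 1)); [|term_eq ..].
  rewrite (@isum_at wo (w (3 * s - (s - 1))) (s) (s + 1)); [|term_eq ..].
  rewrite (@isum_at wo (w (s + 1 - s)) (0) (1)); [|term_eq ..].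
  rewrite (@isum_at wo (w (4 * s - 1 - 2 * s)) (s - 1) (s)); [|term_eq ..].
  rewrite (@isum_at we (w (6 * s - 1 - (2 * s + 1))) (2 * s - 1) (2 * s)); [|term_eq ..].
  rewrite (@isum_at wo (w (8 * s - 1 - 4 * s)) (2 * s - 1) (2 * s)); [|term_eq ..].
  have -> : isum w 1 (4 * s - 1).+1 = isum wo 0 (2 * s) + isum we 1 (2 * s).
    rewrite [in RHS](_ : 2 * s = (2 * s - 1).+1); last by lia.
    by rewrite -isum_parity_odd; congr (isum w 1 _); lia.
  have := @isum_cuts wo 0 [:: 1; s - 1; s; s + 1; 2 * s - 1; 2 * s].
  have := @isum_cuts we 1 [:: 2 * s - 1; 2 * s].
  rewrite /= => ->; last by lia.
  by move=> ->; lia.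
move=> w; rewrite !big_cat /= !pair_seg_ends !big_cons big_nil /=.
rewrite (@sum_asc w _ (4 * s + 1) (6 * s - 1)); [|term_eq ..].
rewrite (@sum_desc w _ (6 * s) (8 * s - 2)); [|term_eq ..].
rewrite (@sum_asc w _ (1) (s - 1)); [|term_eq ..].
rewrite (@sum_desc w _ (3 * s + 1) (4 * s - 1)); [|term_eq ..].
rewrite (@sum_asc w _ (s + 2) (2 * s)); [|term_eq ..].
rewrite (@sum_desc w _ (2 * s + 2) (3 * s)); [|term_eq ..].
have := @isum_cuts w 1 [:: s - 1; s; s + 1; s + 2; 2 * s; 2 * s + 1; 2 * s + 2; 3 * s; 3 * s + 1;
  4 * s - 1; 4 * s; 4 * s + 1; 6 * s - 1; 6 * s; 8 * s - 2].
have -> : (2 * (4 * s - 1)).+1 = 8 * s - 1 by lia.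
rewrite (_ : 2 * (4 * s - 1) = 8 * s - 2) /=; last by lia.
rewrite (@isum1 w (s - 1) (s)); last by lia.
rewrite (@isum1 w (s) (s + 1)); last by lia.
rewrite (@isum1 w (s + 1) (s + 2)); last by lia.
rewrite (@isum1 w (2 * s) (2 * s + 1)); last by lia.
rewrite (@isum1 w (2 * s + 1) (2 * s + 2)); last by lia.
rewrite (@isum1 w (3 * s) (3 * s + 1)); last by lia.
rewrite (@isum1 w (4 * s - 1) (4 * s)); last by lia.
rewrite (@isum1 w (4 * s) (4 * s + 1)); last by lia.
rewrite (@isum1 w (6 * s - 1) (6 * s)); last by lia.
by move=> ->; lia.
Qed.

(** For an explicit list, equality under all weights follows from a permutation test that computes;
    [t] has room for a hook. *)
Lemma sum_perm_iota w s n t : perm_eq s (index_iota 1 n ++ t) ->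
  \sum_(x <- s) w x = isum w 1 n + \sum_(x <- t) w x.
Proof. by move=> st; rewrite (perm_big _ st) big_cat. Qed.

Definition pair_ends (ps : seq (nat * nat)) := map fst ps ++ map snd ps.

Lemma sum_pair_ends w ps : \sum_(p <- ps) (w p.1 + w p.2) = \sum_(x <- pair_ends ps) w x.
Proof. by rewrite big_split /pair_ends big_cat !big_map. Qed.

Lemma differences_cover_check r ps :
  [&& all (fun p => p.1 <= p.2) ps, size ps == r
    & perm_eq [seq p.2 - p.1 | p <- ps] (index_iota 1 r.+1 ++ [::])] -> differences_cover r ps.
Proof.
case/and3P=> le_ps /eqP sr /sum_perm_iota dw; split=> // w.
by rewrite -(big_map (fun p => p.2 - p.1) xpredT w) dw big_nil addn0.
Qed.

Lemma skolem_tight_check r ps : differences_cover r ps ->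
  perm_eq (pair_ends ps) (index_iota 1 (2 * r).+1 ++ [::]) -> tight 3 r.
Proof.
move=> pt /sum_perm_iota pe; apply: skolem_tight pt _ => w.
by rewrite sum_pair_ends pe big_nil addn0.
Qed.

Lemma skolem_hooked_check r ps : 0 < r -> differences_cover r ps ->
  perm_eq (pair_ends ps) (index_iota 1 (2 * r) ++ [:: (2 * r).+1]) -> hooked 3 r.
Proof.
move=> r0 pt /sum_perm_iota pe; apply: skolem_hooked pt _ => // w.
by rewrite sum_pair_ends pe big_seq1.
Qed.

Lemma tight_or_hooked3 r : 0 < r -> tight 3 r \/ hooked 3 r.
Proof.
(* The orders 1 to 5 lie below the range of the general families. *)
have [->|r1] := eqVneq r 1.
  by left; apply: (@skolem_tight_check _ [:: (1, 2)]) => //; apply: differences_cover_check.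
have [->|r2] := eqVneq r 2.
  by right; apply: (@skolem_hooked_check _ [:: (3, 5); (1, 2)]) => //; apply: differences_cover_check.
have [->|r3] := eqVneq r 3.
  by right; apply: (@skolem_hooked_check _ [:: (1, 4); (5, 7); (2, 3)]) => //;
    apply: differences_cover_check.
have [->|r4] := eqVneq r 4.
  by left; apply: (@skolem_tight_check _ [:: (1, 5); (3, 6); (2, 4); (7, 8)]) => //;
    apply: differences_cover_check.
have [->|r5] := eqVneq r 5.
  by left; apply: (@skolem_tight_check _ [:: (1, 6); (3, 7); (5, 8); (2, 4); (9, 10)]) => //;
    apply: differences_cover_check.
move=> r0; have : r %% 4 < 4 by rewrite ltn_mod.
case E: (r %% 4) => [|[|[|[|//]]]] _.
- by left; rewrite (_ : r = 4 * (r %/ 4)); [apply: skolem_mod0|]; lia.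
- by left; rewrite (_ : r = 4 * (r %/ 4) + 1); [apply: skolem_mod1|]; lia.
- by right; rewrite (_ : r = 4 * (r %/ 4) + 2); [apply: hooked_skolem_mod2|]; lia.
- by right; rewrite (_ : r = 4 * (r %/ 4).+1 - 1); [apply: hooked_skolem_mod3|]; lia.
Qed.

(** * Blocks of size 5 *)

Lemma sum_gap2 w a f :
  \sum_(0 <= i < 2 * f) (w (a + i + 2 * i./2) + w (a + i + 2 * i./2 + 2)) = isum w a (a + 4 * f).
Proof.
elim: f => [|f IH]; first by rewrite big_geq // isum0 // addn0.
rewrite (_ : 2 * f.+1 = (2 * f).+2); last by lia.
rewrite !big_nat_recr //= IH [RHS](@isum_split w (a + 4 * f)); last by lia.
rewrite [isum w (a + 4 * f) _]/isum /index_iota (_ : _ - _ = 4); last by lia.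
rewrite /= !big_cons big_nil !mul2n uphalf_double doubleK -!mul2n.
rewrite (_ : a + 2 * f + 2 * f = a + 4 * f); last by lia.
rewrite (_ : a + (2 * f).+1 + 2 * f = a + (4 * f).+1); last by lia.
by rewrite !addnS !addn0; lia.
Qed.

Lemma sum_step2 w a n :
  \sum_(0 <= i < n) (w (a + 2 * i) + w (a + 2 * i).+1) = isum w a (a + 2 * n).
Proof.
elim: n => [|n IH]; first by rewrite big_geq // isum0 // addn0.
rewrite big_nat_recr //= IH [RHS](@isum_split w (a + 2 * n)); last by lia.
rewrite (_ : a + 2 * n.+1 = (a + 2 * n).+2); last by lia.
by rewrite [isum w (_ + _) _.+2]isum_recl // isumS.
Qed.

(* A block is a difference [d] with two pairs: for even [d] a nested pair of difference [d - 1]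
   and a consecutive pair, for odd [d] a nested pair of difference [d + 2] and a pair of
   difference 2. When the number [o] of odd [d] is odd, the last such pair makes the hook. *)
Lemma quintuple_blocks e o r a : o = e.+1 \/ o = e.+2 -> r = e.+1 + o -> a = r + 4 * e.+1 + 2 * o + 1 ->
  exists ss, [/\ zero_blocks 0 5 ss, size ss = r
    & forall w, wsum w ss = isum w 1 a +
        \sum_(0 <= i < o) (w (a + i + 2 * i./2) + w (a + i + 2 * i./2 + 2))].
Proof.
move=> oe rE aE.
have [g1 g1E] : exists g1, g1 = r + e + 2 by eexists.
have [g2 g2E] : exists g2, g2 = r + 2 * e + o + 4 by eexists.
have [d dE] : exists d, d = r + 2 * e + 2 * o + 5 by eexists.
pose ev i p : seq int := [:: Posz (2 * i + 2); Posz (g1 - 1 - i); - Posz (g1 + i); Posz p; - Posz p.+1]%R.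
pose od i p : seq int := [:: Posz (2 * i + 1); Posz (g2 - 2 - i); - Posz (g2 + 1 + i); - Posz p; Posz (p + 2)]%R.
(* The odd nest starts at difference 3, so its centre leaves [g2 - 1] and [g2] free; they are the
   consecutive pair of the first even block. The starting points [a + i + 2 * i./2] are a, a + 1, a
   + 4, a + 5, ...: two interleaved pairs of difference 2 fill four consecutive numbers. *)
exists ([:: ev 0 (g2 - 1)] ++ [seq ev i.+1 (d + 2 * i) | i <- index_iota 0 e]
  ++ [seq od i (a + i + 2 * i./2) | i <- index_iota 0 o]); split=> [||w].
- apply: zero_blocks_cat; first apply: zero_blocks_cons (zero_blocks_nil _ _) => //.
    by rewrite !big_cons big_nil dvd0z; lia.
  by apply: zero_blocks_cat; apply: zero_blocks_map => i ie;
    rewrite !big_cons big_nil dvd0z; split=> //; lia.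
- by rewrite !size_cat !size_map !size_iota /=; lia.
rewrite !wsum_cat !wsum_map wsum_cons /wsum big_nil addn0.
have [E EE] : exists E : nat -> nat, forall i, E i = w (2 * i + 2) + (w (g1 - 1 - i) + w (g1 + i)).
  by exists (fun i => w (2 * i + 2) + (w (g1 - 1 - i) + w (g1 + i))).
have evE i p : \sum_(x <- ev i p) w `|x|%N = E i + (w p + w p.+1).
  by rewrite !big_cons big_nil !abszN !absz_nat EE; lia.
have odE i p : \sum_(x <- od i p) w `|x|%N =
    w (2 * i + 1) + (w (g2 - 2 - i) + w (g2 + 1 + i)) + (w p + w (p + 2)).
  by rewrite !big_cons big_nil !abszN !absz_nat; lia.
rewrite evE (eq_bigr _ (fun i _ => evE i.+1 _)) (eq_bigr _ (fun i _ => odE i _)) !big_split /=.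
have E0 : E 0 + \sum_(0 <= i < e) E i.+1 = \sum_(0 <= i < e.+1) E i by rewrite big_nat_recl.
have Esum : \sum_(0 <= i < e.+1) E i = isum (fun x => w (2 * x)) 1 e.+2 + isum w r.+1 (r + 2 * e + 3).
  rewrite (eq_bigr _ (fun i _ => EE i)) !big_split /= (@isum_split w g1 r.+1); last by lia.
  rewrite (@sum_asc (fun x => w (2 * x)) _ 1 e.+2); [|term_eq ..].
  rewrite (@sum_desc w _ r.+1 g1) ; [|term_eq ..].
  by rewrite (@sum_asc w _ g1 (r + 2 * e + 3)); [|term_eq ..].
have dd : \sum_(0 <= i < e) w (d + 2 * i) + \sum_(0 <= i < e) w (d + 2 * i).+1 = isum w d (d + 2 * e).
  by rewrite -big_split sum_step2.
rewrite (@sum_asc (fun x => w (2 * x).+1) _ 0 o o); [|term_eq ..].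
rewrite (@sum_desc w _ (g2 - 1 - o) (g2 - 1) o); [|term_eq ..].
rewrite (@sum_asc w _ (g2 + 1) (g2 + 1 + o) o); [|term_eq ..].
have da : d + 2 * e = a by lia.
have gE : (g2 - 1).+1 = g2 by lia.
rewrite da in dd; rewrite gE.
have := @isum_cuts w 1 [:: r.+1; r + 2 * e + 3; g2 - 1; g2; g2.+1; d; a].
rewrite /= (@isum1 w (g2 - 1) g2) ?isumS; last by lia.
have -> : isum w 1 r.+1 = isum (fun x => w (2 * x)) 1 e.+2 + isum (fun x => w (2 * x).+1) 0 o.
  by case: oe => oE; rewrite oE in rE *; rewrite addnC -?isum_parity_odd -?isum_parity;
     congr (isum w 1 _); lia.
have -> : g2 - 1 - o = r + 2 * e + 3 by lia.
have -> : g2 + 1 + o = d by lia.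
by rewrite (addn1 g2) => ->; lia.
Qed.

Lemma wsum_perm w ss n t : perm_eq [seq `|x|%N | x <- flatten ss] (index_iota 1 n ++ t) ->
  wsum w ss = isum w 1 n + \sum_(x <- t) w x.
Proof. by move=> st; rewrite -wsum_flatten -(big_map absz xpredT w) (sum_perm_iota w st). Qed.

Lemma tight_or_hooked5 r : 0 < r -> tight 5 r \/ hooked 5 r.
Proof.
move=> r0; have [->|r1] := eqVneq r 1.
  (* For r = 1 there is no even difference to fill the hole in the odd nest. *)
  right; exists [:: [:: 6; 2; -1; -3; -4]%R]; split=> // [|w].
    by apply: zero_blocks_cons => //; rewrite !big_cons big_nil dvd0z.
  by rewrite (@wsum_perm w _ 5 [:: 6]) ?big_seq1.
have [ss [zs sr ws]] := @quintuple_blocks (r %/ 2 - 1) (r - r %/ 2) r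
  (5 * r - 2 * (r - r %/ 2) + 1) ltac:(lia) ltac:(lia) ltac:(lia).
have [f oE] : exists f, r - r %/ 2 = 2 * f \/ r - r %/ 2 = (2 * f).+1.
  by exists ((r - r %/ 2) %/ 2); lia.
move: ws; set a := _ + 1; have aE : a = 5 * r - 2 * (r - r %/ 2) + 1 by [].
move: a aE => a aE ws; case: oE => oE; [left|right]; exists ss; split=> // w; rewrite ws oE.
  by rewrite sum_gap2 -isum_split; [congr (isum w 1 _)|]; lia.
rewrite big_nat_recr //= sum_gap2 mul2n doubleK -mul2n addnA -isum_split; last by lia.
rewrite (@isum_split w (5 * r - 1) 1 (5 * r)) ?(@isum1 w (5 * r - 1)); try lia.
by rewrite addnA; congr (isum w 1 _ + w _ + w _); lia.
Qed.

(** * All block sizes, and arrays with an even number of columns *)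

Lemma tight_or_hooked m r : 2 < m -> 0 < r -> tight m r \/ hooked m r.
Proof.
move=> m2 r0; have ext k j : 0 < k -> tight k r \/ hooked k r ->
    tight (k + 4 * j) r \/ hooked (k + 4 * j) r.
  by move=> k0 [/tight_extend|/hooked_extend] H; [left|right]; apply: H.
have [k [j [mE kP]]] : exists k j, m = k + 4 * j /\ [\/ k = 3, k = 4, k = 5 | k = 6].
  exists (3 + (m - 3) %% 4), ((m - 3) %/ 4); split; first by lia.
  have : (m - 3) %% 4 < 4 by rewrite ltn_mod.
  by case: (_ %% 4) => [|[|[|[|//]]]] _; [apply: Or41|apply: Or42|apply: Or43|apply: Or44].
rewrite mE; apply: ext; first by case: kP => ->.
case: kP => ->; [exact: tight_or_hooked3|left; exact: tight4|exact: tight_or_hooked5|].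
by rewrite -(odd_double_half r) -mul2n; case: (odd r); [right; apply: hooked6|left; apply: tight6].
Qed.

Lemma even_weight_abs v w (x : int) : even_weight v w -> w (Posz `|x|%N) = w x.
Proof. by case=> wN _; case: (intP x) => [|n|n]; rewrite ?abszN ?absz_nat ?wN. Qed.

Lemma even_weight_wsum v w ss : even_weight v w ->
  wsum (fun d => w (Posz d)) ss = \sum_(x <- flatten ss) w x.
Proof.
move=> ew; rewrite big_flatten; apply: eq_bigr => c _; apply: eq_bigr => x _.
exact: even_weight_abs ew.
Qed.

Lemma even_weight_refl v w d : even_weight v w -> d <= v -> w (Posz (v - d)) = w (Posz d).
Proof.
by case=> wN wv dv; rewrite -wN; apply: wv; rewrite -subzn // opprB addrAC subrr sub0r dvdz_opp.
Qed.

Lemma isum_refl v w b : even_weight v w -> b <= v ->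
  isum (fun d => w (Posz d)) (v - b) v = isum (fun d => w (Posz d)) 1 b.+1.
Proof.
move=> ew; elim: b => [|b IH] bv; first by rewrite !isum0 ?subn0.
rewrite (@isum_split _ b.+1 1 b.+2); last by lia.
rewrite isumS -(even_weight_refl ew bv) -IH; last by lia.
rewrite (@isum_recl _ (v - b.+1) v); last by lia.
by rewrite addnC (_ : (v - b.+1).+1 = v - b); last by lia.
Qed.

Lemma sum_double_blocks (w : int -> nat) (ss : seq (seq int)) :
  \sum_(x <- flatten [seq c ++ c | c <- ss]) w x = 2 * \sum_(x <- flatten ss) w x.
Proof.
by elim: ss => [|c ss IH] /=; rewrite ?big_nil // !big_cat IH /=; lia.
Qed.

Lemma realizable_even m r : 2 < m -> 0 < r -> realizable m (2 * r).
Proof.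
move=> m2 r0; rewrite /realizable; set v := _ + 1.
have [ss [zs sr ws]] : exists ss, [/\ zero_blocks v m ss, size ss = r &
    forall w, even_weight v w ->
      \sum_(x <- flatten ss) w x = isum (fun d => w (Posz d)) 1 (m * r).+1].
  case: (tight_or_hooked m2 r0) => -[ss [zs sr ws]]; exists ss; split=> //;
    try exact: zero_blocks_mod; move=> w ew; rewrite -(even_weight_wsum _ ew) ws //.
  (* Only the hooked case is left: mr and mr + 1 add up to v, so they have the same weight. *)
  have mr0 : 0 < m * r by rewrite muln_gt0 r0; lia.
  have mrv : m * r <= v by rewrite /v; lia.
  rewrite (@isum_split _ (m * r) 1 (m * r).+1) ?isumS; last by lia.
  by rewrite -(even_weight_refl ew mrv) (_ : v - m * r = (m * r).+1) // /v; lia.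
exists ([::] ++ flatten [seq c ++ c | c <- ss]).
  by rewrite -sr; have := realizes_cols (realizes_nil v m) zs; rewrite add0n.
move=> w ew; rewrite sum_double_blocks ws // -/(isum (fun d => w (Posz d)) 1 v).
rewrite [RHS](@isum_split _ (m * r).+1); last by rewrite /v; lia.
(* The second copy of 1, ..., mr is reflected onto mr + 1, ..., v - 1. *)
rewrite mul2n -addnn -{2}(isum_refl ew); last by rewrite /v; lia.
by congr (_ + isum _ _ _); rewrite /v; lia.
Qed.

(** * Odd sides: the 3 x 3 corner and its extension *)

Definition rows_array (rows : seq (seq int)) (i j : nat) : int := nth 0%R (nth [::] rows i) j.

(** By symmetry off-diagonal entries come twice, and the last two diagonal entries are opposite, so
    only h = 2K is single. The first row makes its last two entries add up to h; adding the other
    two rows then forces twice their common entry to be h, whence K. The parameter [x] stays free,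
    to be fitted to a hole. *)
Lemma special33 K x : x <= 2 * K ->
  realizes (4 * K) 3 3 [:: Posz (2 * K); Posz x; Posz x; Posz (2 * K - x); Posz (2 * K - x);
    Posz K; Posz K; Posz (x + K); Posz (x + K)].
Proof.
move=> xK; exists (rows_array
  [:: [:: Posz (2 * K); Posz x; Posz (2 * K - x)];
      [:: Posz x; - Posz (x + K); Posz K];
      [:: Posz (2 * K - x); Posz K; Posz (x + K)]]%R).
split=> [i i3|j j3|w [wN _]].
- rewrite /index_iota /rows_array /= !big_cons big_nil.
  case: i i3 => [|[|[|//]]] _ /=.
  + by apply/dvdzP; exists 1%R; lia.
  + by apply/dvdzP; exists 0%R; lia.
  + by apply/dvdzP; exists 1%R; lia.
- rewrite /index_iota /rows_array /= !big_cons big_nil.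
  case: j j3 => [|[|[|//]]] _ /=.
  + by apply/dvdzP; exists 1%R; lia.
  + by apply/dvdzP; exists 0%R; lia.
  + by apply/dvdzP; exists 1%R; lia.
by rewrite /index_iota /rows_array /= !big_cons !big_nil /= !wN; lia.
Qed.

Lemma isum_odd v w h : even_weight v w -> v = 2 * h -> 0 < h ->
  isum (fun d => w (Posz d)) 1 v = 2 * isum (fun d => w (Posz d)) 1 h + w (Posz h).
Proof.
move=> ew vh h0; rewrite (@isum_split _ h.+1 1 v); last by lia.
rewrite (@isum_split _ h 1 h.+1); last by lia.
have hv : h - 1 <= v by lia.
have := isum_refl ew hv; rewrite (_ : v - (h - 1) = h.+1); last by lia.
rewrite (_ : (h - 1).+1 = h) => [->|]; last by lia.
by rewrite isumS mul2n -addnn addnAC.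
Qed.

(** [2 * j] triples become pairs of opposite rows beside the transposed corner; the remaining
    [1 + 2 * b] triples, each lengthened by [j] quadruples, become pairs of opposite columns. All
    triples are interchangeable, so one list serves both uses. *)
Lemma odd_assembly K x j b tr qs : x <= 2 * K -> 4 * K = (5 + 4 * b) * (3 + 4 * j) + 1 ->
  zero_blocks 0 3 tr -> size tr = 2 * j + (1 + 2 * b) ->
  zero_blocks 0 4 qs -> size qs = j * (1 + 2 * b) ->
  (forall w, wsum w tr + wsum w qs + w x + w (2 * K - x) + w K + w (x + K) = isum w 1 (2 * K)) ->
  realizable (3 + 4 * j) (5 + 4 * b).
Proof.
move=> xK vE zt st zq sq ws; have K0 : 0 < K by lia.
rewrite /realizable -{}vE.
have zt1 : zero_blocks 0 3 (take (2 * j) tr) by move=> c /mem_take /zt.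
have zt2 : zero_blocks 0 3 (drop (2 * j) tr) by move=> c /mem_drop /zt.
have st1 : size (take (2 * j) tr) = 2 * j by rewrite size_takel // st; lia.
have st2 : size (drop (2 * j) tr) = 1 + 2 * b by rewrite size_drop st; lia.
have [|ss [zs ss2 wss]] := blocks_extend _ zt2 zq (j := j); first by rewrite st2.
have R1 := realizes_tr (realizes_cols (special33 xK) (@zero_blocks_mod (4 * K) _ _ zt1)).
rewrite st1 (_ : 3 + 2 * (2 * j) = 3 + 4 * j) in R1; last by lia.
have := realizes_cols R1 (@zero_blocks_mod (4 * K) _ _ zs).
rewrite ss2 st2 (_ : 3 + 2 * _ = 5 + 4 * b); last by lia.
set l := _ ++ _ => R2; exists l => // w ew.
rewrite -/(isum (fun d => w (Posz d)) 1 (4 * K)) (@isum_odd _ _ (2 * K) ew); try lia.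
rewrite -ws !big_cat /= !sum_double_blocks -!(even_weight_wsum _ ew) wss.
rewrite -{3}(cat_take_drop (2 * j) tr) wsum_cat !big_cons big_nil; lia.
Qed.

(** Two pairs of consecutive numbers cancel wherever they lie: a - (a + 1) - c + (c + 1) = 0. So a
    gap of even length can be filled regardless of its position. *)
Lemma quads_of_pairs (s : seq nat) q : size s = 2 * q ->
  exists qs, [/\ zero_blocks 0 4 qs, size qs = q
    & forall w, wsum w qs = \sum_(a <- s) (w a + w a.+1)].
Proof.
elim: q s => [|q IH] s; first by rewrite muln0 => /size0nil ->; exists [::]; split=> // w; rewrite /wsum !big_nil.
case: s => [|a [|c s]] /=; try by lia.
move=> sz; have [|qs [zq sq wq]] := IH s; first by lia.
exists ([:: Posz a; - Posz a.+1; - Posz c; Posz c.+1]%R :: qs); split=> [||w].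
- by apply: zero_blocks_cons => //; rewrite !big_cons big_nil dvd0z; lia.
- by rewrite /= sq.
- by rewrite wsum_cons wq !big_cons big_nil !abszN !absz_nat; lia.
Qed.

Definition run2 a n := [seq a + 2 * i | i <- index_iota 0 n].

Lemma sum_run2 w a n : \sum_(d <- run2 a n) (w d + w d.+1) = isum w a (a + 2 * n).
Proof. by rewrite big_map sum_step2. Qed.

Lemma size_run2 a n : size (run2 a n) = n.
Proof. by rewrite size_map size_iota subn0. Qed.

(* Even differences leave a hole at the centre [x] of their nest; odd ones are contiguous. *)
Lemma nested_triples e x g : e <= x -> e < g ->
  exists tr, [/\ zero_blocks 0 3 tr, size tr = (2 * e).+1
    & forall w, wsum w tr = isum w 1 (2 * e).+2 + (isum w (x - e) x + isum w x.+1 (x + e).+1)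
        + isum w (g - e.+1) (g + e.+1)].
Proof.
move=> ex eg.
exists ([seq [:: Posz (2 * i).+2; Posz (x - 1 - i); - Posz (x + 1 + i)]%R | i <- index_iota 0 e]
  ++ [seq [:: Posz (2 * i).+1; Posz (g - 1 - i); - Posz (g + i)]%R | i <- index_iota 0 e.+1]).
split=> [||w].
- by apply: zero_blocks_cat; apply: zero_blocks_map => i ie;
    rewrite !big_cons big_nil dvd0z; split=> //; lia.
- by rewrite size_cat !size_map !size_iota; lia.
rewrite wsum_cat !wsum_map isum_parity_odd.
under eq_bigr do rewrite !big_cons big_nil !abszN !absz_nat addn0.
under [X in _ + X]eq_bigr do rewrite !big_cons big_nil !abszN !absz_nat addn0.
rewrite !big_split /=.
rewrite (@sum_asc (fun x => w (2 * x)) _ 1 e.+1); [|term_eq ..].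
rewrite (@sum_desc w _ (x - e) x); [|term_eq ..].
rewrite (@sum_asc w _ x.+1 (x + e).+1); [|term_eq ..].
rewrite (@sum_asc (fun x => w (2 * x).+1) _ 0 e.+1); [|term_eq ..].
rewrite (@sum_desc w _ (g - e.+1) g); [|term_eq ..].
rewrite (@sum_asc w _ g (g + e.+1)); [|term_eq ..].
rewrite (@isum_split w g (g - e.+1) (g + e.+1)); lia.
Qed.

(** The corner entry [x] fills the hole of the even nest and is chosen so that this nest ends just
    below [K]. Since [e] is odd, pairing off the numbers between [K] and [2 * K - x] leaves one
    over; the neighbours of [2 * K - x] and those of [x + K], two pairs of difference 2, form one
    extra quadruple. *)
Lemma odd_triples_quads_odd f n e K x : e = (2 * f).+1 -> K = 4 * e + 7 + 2 * n -> x = K - 1 - e ->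
  exists tr qs, [/\ zero_blocks 0 3 tr, size tr = (2 * e).+1, zero_blocks 0 4 qs,
    size qs = n + f + 2 & forall w,
    wsum w tr + wsum w qs + w x + w (2 * K - x) + w K + w (x + K) = isum w 1 (2 * K)].
Proof.
move=> ef Kn xE.
have [||tr [zt st wt]] := @nested_triples e x (K + 2 * e + 4); try lia.
have [|qs [zq sq wq]] := @quads_of_pairs (run2 (2 * e + 2) (n + 2) ++ run2 K.+1 f ++
  run2 (K + 3 * e + 5) n ++ run2 (2 * K - e).+1 f) (n + f + 1).
  by rewrite !size_cat !size_run2; lia.
exists tr, ([:: Posz (K + e); - Posz (K + e).+2; - Posz (2 * K - 2 - e); Posz (2 * K - e)]%R :: qs).
split=> //; first by apply: zero_blocks_cons => //; rewrite !big_cons big_nil dvd0z; lia.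
  by rewrite /= sq; lia.
move=> w; rewrite wt wsum_cons wq !big_cat /= !sum_run2 !big_cons big_nil !abszN !absz_nat.
have := @isum_cuts w 1 [:: (2 * e).+2; x - e; x; x.+1; K; K.+1; K + e; (K + e).+1; (K + e).+2;
  (K + e).+3; K + 3 * e + 5; 2 * K - 2 - e; 2 * K - 1 - e; 2 * K - e; (2 * K - e).+1; 2 * K].
rewrite /= !isumS (@isum1 w (2 * K - 2 - e)); last by lia.
rewrite (@isum1 w (2 * K - 1 - e)); last by lia.
rewrite (_ : (x + e).+1 = K); last by lia.
rewrite (_ : K + 2 * e + 4 - e.+1 = (K + e).+3); last by lia.
rewrite (_ : K + 2 * e + 4 + e.+1 = K + 3 * e + 5); last by lia.
rewrite (_ : 2 * e + 2 + 2 * (n + 2) = x - e); last by lia.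
rewrite (_ : 2 * e + 2 = (2 * e).+2); last by lia.
rewrite (_ : K.+1 + 2 * f = K + e); last by lia.
rewrite (_ : K + 3 * e + 5 + 2 * n = 2 * K - 2 - e); last by lia.
rewrite (_ : (2 * K - e).+1 + 2 * f = 2 * K); last by lia.
rewrite (_ : 2 * K - x = (K + e).+1); last by lia.
rewrite (_ : x + K = 2 * K - 1 - e); last by lia.
by move=> ->; lia.
Qed.

(** For even [e] the nest is moved down by one, so the two pairs of difference 2 straddle [K] and
    [x + K] instead. *)
Lemma odd_triples_quads_even f n e K x : e = 2 * f -> K = 4 * e + 8 + 2 * n -> x = K - 2 - e ->
  exists tr qs, [/\ zero_blocks 0 3 tr, size tr = (2 * e).+1, zero_blocks 0 4 qs,
    size qs = n + f + 2 & forall w,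
    wsum w tr + wsum w qs + w x + w (2 * K - x) + w K + w (x + K) = isum w 1 (2 * K)].
Proof.
move=> ef Kn xE.
have [||tr [zt st wt]] := @nested_triples e x (K + 2 * e + 4); try lia.
have [|qs [zq sq wq]] := @quads_of_pairs (run2 (2 * e + 2) (n + 2) ++ run2 K.+2 f ++
  run2 (K + 3 * e + 5) n ++ run2 (2 * K - e) f) (n + f + 1).
  by rewrite !size_cat !size_run2; lia.
exists tr, ([:: Posz (K - 1); - Posz K.+1; - Posz (2 * K - 3 - e); Posz (2 * K - 1 - e)]%R :: qs).
split=> //; first by apply: zero_blocks_cons => //; rewrite !big_cons big_nil dvd0z; lia.
  by rewrite /= sq; lia.
move=> w; rewrite wt wsum_cons wq !big_cat /= !sum_run2 !big_cons big_nil !abszN !absz_nat.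
have := @isum_cuts w 1 [:: (2 * e).+2; x - e; x; x.+1; K - 1; K; K.+1; K.+2; (K + e).+2;
  (K + e).+3; K + 3 * e + 5; 2 * K - 3 - e; 2 * K - 2 - e; 2 * K - 1 - e; 2 * K - e; 2 * K].
rewrite /= !isumS (@isum1 w (K - 1)); last by lia.
rewrite (@isum1 w (2 * K - 3 - e)); last by lia.
rewrite (@isum1 w (2 * K - 2 - e)); last by lia.
rewrite (@isum1 w (2 * K - 1 - e)); last by lia.
rewrite (_ : (x + e).+1 = K - 1); last by lia.
rewrite (_ : K + 2 * e + 4 - e.+1 = (K + e).+3); last by lia.
rewrite (_ : K + 2 * e + 4 + e.+1 = K + 3 * e + 5); last by lia.
rewrite (_ : 2 * e + 2 + 2 * (n + 2) = x - e); last by lia.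
rewrite (_ : 2 * e + 2 = (2 * e).+2); last by lia.
rewrite (_ : K.+2 + 2 * f = (K + e).+2); last by lia.
rewrite (_ : K + 3 * e + 5 + 2 * n = 2 * K - 3 - e); last by lia.
rewrite (_ : 2 * K - e + 2 * f = 2 * K); last by lia.
rewrite (_ : 2 * K - x = (K + e).+2); last by lia.
rewrite (_ : x + K = 2 * K - 2 - e); last by lia.
by move=> ->; lia.
Qed.

Lemma wsum_special_check K x tr qs :
  perm_eq [seq `|y|%N | y <- flatten (tr ++ qs ++ [:: [:: Posz x; Posz (2 * K - x); Posz K; Posz (x + K)]])]
    (index_iota 1 (2 * K) ++ [::]) ->
  forall w, wsum w tr + wsum w qs + w x + w (2 * K - x) + w K + w (x + K) = isum w 1 (2 * K).
Proof.
move=> /wsum_perm pe w; have := pe w.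
by rewrite !wsum_cat wsum_cons /wsum !big_nil !big_cons big_nil !absz_nat !addn0 => <-; lia.
Qed.

Lemma zero_blocks_check m ss :
  all (fun c => (size c == m) && (\sum_(x <- c) x == 0)%R) ss -> zero_blocks 0 m ss.
Proof. by move=> /allP H c /H /andP[/eqP sc /eqP->]. Qed.

Lemma realizable_odd_large j b : 0 < j ->
  realizable (3 + 4 * j) (5 + 4 * b).
Proof.
move=> j0.
(* For b = 0 and j = 1 or 2 the number [n] of the general layout would be negative, so the 7 x 5 and
   11 x 5 arrays get explicit blocks. *)
have [/andP[/eqP-> /eqP->]|n1] := boolP ((j == 1) && (b == 0)).
  apply: (@odd_assembly 9 1 1 0 [:: [:: -16%:Z; 11; 5]; [:: -15%:Z; 8; 7]; [:: -14%:Z; 12; 2]]%R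
    [:: [:: -13%:Z; 3; 4; 6]]%R) => //.
  - by apply: zero_blocks_check; rewrite /= !big_cons !big_nil.
  - by apply: zero_blocks_check; rewrite /= !big_cons !big_nil.
  - exact: wsum_special_check.
have [/andP[/eqP-> /eqP->]|n2] := boolP ((j == 2) && (b == 0)).
  apply: (@odd_assembly 14 2 2 0 [:: [:: -27%:Z; 15; 12]; [:: -25%:Z; 17; 8];
    [:: -24%:Z; 13; 11]; [:: -23%:Z; 18; 5]; [:: -22%:Z; 21; 1]]%R
    [:: [:: -20%:Z; -3; 4; 19]; [:: -10; -6; 7; 9]]%R) => //.
  - by apply: zero_blocks_check; rewrite /= !big_cons !big_nil.
  - by apply: zero_blocks_check; rewrite /= !big_cons !big_nil.
  - exact: wsum_special_check.
have bjb : b <= b * j by rewrite leq_pmulr.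
(* Here 4K = v, and [K] has the parity of [b + j], so that [n] is an integer in both cases below. *)
pose K := 4 + 3 * b + 5 * j + 4 * (b * j).
have [f] : exists f, b + j = (2 * f).+1 \/ b + j = 2 * f by exists ((b + j) %/ 2); lia.
case=> eE.
  have [n nE] : exists n, K = 4 * (b + j) + 7 + 2 * n.
    by exists ((j + 4 * (b * j) - b - 3) %/ 2); rewrite /K; lia.
  have [tr [qs [zt st zq sq ws]]] := odd_triples_quads_odd eE nE (erefl _).
  by apply: (odd_assembly _ _ zt _ zq _ ws); rewrite ?st ?sq /K in nE *; nia.
have [n nE] : exists n, K = 4 * (b + j) + 8 + 2 * n.
  by exists ((j + 4 * (b * j) - b - 4) %/ 2); rewrite /K; lia.
have [tr [qs [zt st zq sq ws]]] := odd_triples_quads_even eE nE (erefl _).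
by apply: (odd_assembly _ _ zt _ zq _ ws); rewrite ?st ?sq /K in nE *; nia.
Qed.

(** * Arrays with three rows *)

Lemma sum_periods w p a n :
  \sum_(0 <= i < n) isum w (a + p * i) (a + p * i + p) = isum w a (a + p * n).
Proof.
elim: n => [|n IH]; first by rewrite big_geq // muln0 addn0 isum0.
rewrite big_nat_recr //= IH -isum_split; last by lia.
by rewrite mulnSr addnA.
Qed.

(* Consecutive residues mod 3: these triples cover [1 .. 6k+1] except its midpoint [3k+1]. *)
Definition tri_even k u : seq int :=
  [:: - Posz (6 * k - 6 * u); - Posz (3 * u + 1); Posz (6 * k + 1 - 3 * u)]%R.
Definition tri_odd k u : seq int :=
  [:: - Posz (6 * k - 3 - 6 * u); Posz (6 * k - 1 - 3 * u); - Posz (3 * u + 2)]%R.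

(** The two families contain the even and the odd multiples of 3. With the smaller entries of
    residues 1 and 2 these multiples complete periods tiling 1, ..., 3k, and with the larger ones
    periods tiling 3k + 2, ..., 6k + 1. *)
Lemma wsum_tri w k :
  \sum_(0 <= u < k) \sum_(x <- tri_even k u) w `|x|%N + \sum_(0 <= u < k) \sum_(x <- tri_odd k u) w `|x|%N
  = isum w 1 (3 * k).+1 + isum w (3 * k).+2 (6 * k).+2.
Proof.
under eq_bigr do rewrite !big_cons big_nil !abszN !absz_nat addn0.
under [X in _ + X]eq_bigr do rewrite !big_cons big_nil !abszN !absz_nat addn0.
rewrite !big_split /=.
pose f x := w (3 * x).
have fsum : \sum_(0 <= u < k) w (6 * k - 6 * u) + \sum_(0 <= u < k) w (6 * k - 3 - 6 * u) =
    isum f 1 (2 * k).+1.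
  rewrite [X in X + _]big_nat_rev [X in _ + X]big_nat_rev /= -big_split /= addnC.
  rewrite -[(2 * k).+1]add1n -sum_step2; apply: eq_big_nat => u uk.
  by rewrite addnC /f; congr (w _ + w _); lia.
have lo : isum f 1 k.+1 + (\sum_(0 <= u < k) w (3 * u + 1) + \sum_(0 <= u < k) w (3 * u + 2)) =
    isum w 1 (3 * k).+1.
  rewrite -[k.+1]add1n -isum_up -!big_split -[(3 * k).+1]add1n -sum_periods /=.
  apply: eq_bigr => u _; rewrite /f /isum /index_iota addKn.
  rewrite /= !big_cons big_nil (_ : 3 * (1 + u) = (1 + 3 * u).+2); last by lia.
  rewrite (_ : 3 * u + 1 = 1 + 3 * u); last by lia.
  rewrite (_ : 3 * u + 2 = (1 + 3 * u).+1); last by lia.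
  by rewrite addn0 addnC addnA.
have hi : isum f k.+1 (2 * k).+1 +
    (\sum_(0 <= u < k) w (6 * k + 1 - 3 * u) + \sum_(0 <= u < k) w (6 * k - 1 - 3 * u)) =
    isum w (3 * k).+2 (6 * k).+2.
  rewrite [X in _ + (X + _)]big_nat_rev [X in _ + (_ + X)]big_nat_rev /=.
  rewrite (_ : (2 * k).+1 = k.+1 + k) -?isum_up -?big_split /=; last by lia.
  rewrite (_ : (6 * k).+2 = (3 * k).+2 + 3 * k) -?sum_periods; last by lia.
  apply: eq_big_nat => u uk; rewrite /f /isum /index_iota addKn.
  rewrite /= !big_cons big_nil addn0.
  rewrite (_ : 3 * (k.+1 + u) = ((3 * k).+2 + 3 * u).+1); last by lia.
  rewrite (_ : 6 * k + 1 - _ = ((3 * k).+2 + 3 * u).+2); last by lia.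
  rewrite (_ : 6 * k - 1 - _ = (3 * k).+2 + 3 * u); last by lia.
  by rewrite addnA addnC.
rewrite -lo -hi addnACA addnA fsum (@isum_split f k.+1 1); last by lia.
have ac (A B c d e g : nat) : A + B + (c + d) + (e + g) = A + (c + g) + (B + (d + e)) by lia.
exact: ac.
Qed.

(* The columns after the first are the triples (-1, -6k, 6k+1) and (3k+2, -3, -(3k-1)) of
   [tri_even] and [tri_odd], each used twice with its last two entries swapped; the rows balance
   because 3k+2 - 1 = 3k+1 is half of the element 6k+2 of order 2. *)
Lemma special35 k : 0 < k ->
  let y := Posz (3 * k + 1) in let a := Posz 1 in let b := Posz (6 * k) in
  let c := Posz (6 * k + 1) in let a' := Posz (3 * k + 2) in let b' := Posz 3 in
  let c' := Posz (3 * k - 1) in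
  realizes (12 * k + 4) 3 5
    [:: Posz (6 * k + 2); a; a; a'; a'; y; b; c; b'; c'; y; c; b; c'; b'].
Proof.
move=> k0 y a b c a' b' c'; exists (rows_array
  [:: [:: Posz (6 * k + 2); - a; - a; a'; a'];
      [:: y; - b; c; - b'; - c'];
      [:: y; c; - b; - c'; - b']]%R).
split=> [i i3|j j5|w [wN _]].
- rewrite /index_iota /rows_array /= !big_cons big_nil.
  case: i i3 => [|[|[|//]]] _ /=.
  + by apply/dvdzP; exists 1%R; lia.
  + by apply/dvdzP; exists 0%R; lia.
  + by apply/dvdzP; exists 0%R; lia.
- rewrite /index_iota /rows_array /= !big_cons big_nil.
  case: j j5 => [|[|[|[|[|//]]]]] _ /=; apply/dvdzP; [exists 1%R|exists 0%R ..]; lia.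
by rewrite /index_iota /rows_array /= !big_cons !big_nil /= !wN; lia.
Qed.

Lemma realizable_odd3 k : 0 < k ->
  realizable 3 (4 * k + 1).
Proof.
move=> k0; rewrite /realizable (_ : (4 * k + 1) * 3 + 1 = 12 * k + 4); last by lia.
(* The corner has consumed [tri_even k 0] and [tri_odd k (k - 1)], hence the shift in one family and
   the shorter range in the other. *)
pose ss := [seq tri_even k u.+1 | u <- index_iota 0 (k - 1)] ++
  [seq tri_odd k u | u <- index_iota 0 (k - 1)].
have zs : zero_blocks 0 3 ss.
  by apply: zero_blocks_cat; apply: zero_blocks_map => u uk;
    rewrite !big_cons big_nil dvd0z; split=> //; lia.
have sz : size ss = 2 * (k - 1) by rewrite size_cat !size_map !size_iota; lia.
have := realizes_cols (special35 k0) (@zero_blocks_mod (12 * k + 4) _ _ zs).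
rewrite sz (_ : 5 + 2 * _ = 4 * k + 1); last by lia.
set l := _ ++ _ => R; exists l => // w ew.
rewrite -/(isum (fun d => w (Posz d)) 1 (12 * k + 4)) (@isum_odd _ _ (6 * k + 2) ew); try lia.
rewrite (@isum_split _ (3 * k).+1 1 (6 * k + 2)); last by lia.
rewrite (@isum_split _ (3 * k).+2 (3 * k).+1 (6 * k + 2)); last by lia.
rewrite isumS !big_cat /= sum_double_blocks -(even_weight_wsum _ ew) !big_cons big_nil.
have := wsum_tri (fun d => w (Posz d)) k.
rewrite (_ : (6 * k).+2 = 6 * k + 2); last by lia.
rewrite wsum_cat !wsum_map; have kE : k = (k - 1).+1 by lia.
have sum_first (F : nat -> nat) : \sum_(0 <= u < k) F u = F 0 + \sum_(0 <= u < k - 1) F u.+1.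
  by rewrite -big_nat_recl // -kE.
have sum_last (F : nat -> nat) : \sum_(0 <= u < k) F u = \sum_(0 <= u < k - 1) F u + F (k - 1).
  by rewrite -big_nat_recr // -kE.
rewrite (sum_first (fun u => \sum_(x <- tri_even k u) _)).
rewrite (sum_last (fun u => \sum_(x <- tri_odd k u) _)).
move: (\sum_(0 <= u < k - 1) _) (\sum_(0 <= u < k - 1) _) => S1 S2.
rewrite !big_cons !big_nil !abszN !absz_nat.
rewrite (_ : 6 * k - 3 - 6 * (k - 1) = 3); last by lia.
rewrite (_ : 6 * k - 1 - 3 * (k - 1) = 3 * k + 2); last by lia.
rewrite (_ : 3 * (k - 1) + 2 = 3 * k - 1); last by lia.
by rewrite !muln0 !subn0 add0n (addn1 (3 * k)); lia.
Qed.

(** * Sufficiency: the cases by parity of the sides *)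

Lemma realizable_sym m n : realizable m n -> realizable n m.
Proof. by case=> l /realizes_tr R W; exists l; rewrite mulnC. Qed.

Lemma realizable_odd m n : 1 < n -> m %% 4 = 3 -> n %% 4 = 1 -> realizable m n.
Proof.
move=> n1 m3 n4; case: (posnP ((m - 3) %/ 4)) => [m0|j0].
  rewrite (_ : m = 3); last by lia.
  by rewrite (_ : n = 4 * (n %/ 4) + 1); [apply: realizable_odd3|]; lia.
rewrite (_ : m = 3 + 4 * ((m - 3) %/ 4)); last by lia.
rewrite (_ : n = 5 + 4 * ((n - 5) %/ 4)); last by lia.
exact: realizable_odd_large.
Qed.

Lemma realizable_all m n : 1 < m -> 1 < n -> (m * n) %% 4 != 1 -> ~ (m = 2 /\ n = 2) ->
  realizable m n.
Proof.
move=> m1 n1 mn ne22.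
(* Blocks need size above 2, so a side of length 2 always serves as the even number of columns. *)
have even_r k l : 2 < k -> 1 < l -> ~~ odd l -> realizable k l.
  by move=> k2 l1 ol; rewrite (_ : l = 2 * l./2); [apply: realizable_even|]; lia.
case: (boolP (odd n)) => [on|en]; last first.
  have [m2|m2] := ltnP 2 m; first exact: even_r.
  by apply: realizable_sym; apply: even_r; lia.
case: (boolP (odd m)) => [om|em]; last by apply: realizable_sym; apply: even_r => //; lia.
have mE : m = 4 * (m %/ 4) + m %% 4 by lia.
have nE : n = 4 * (n %/ 4) + n %% 4 by lia.
have [m4|m4] : m %% 4 = 1 \/ m %% 4 = 3 by lia.
all: have [n4|n4] : n %% 4 = 1 \/ n %% 4 = 3 by lia.
- by move: mn; rewrite -modnMm m4 n4.
- by apply: realizable_sym; apply: realizable_odd.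
- exact: realizable_odd.
- by move: mn; rewrite -modnMm m4 n4.
Qed.

(** * Necessity: parity modulo 4, and the 2 x 2 array *)

Lemma odd_sum I (r : seq I) (F : I -> nat) :
  odd (\sum_(i <- r) F i) = odd (\sum_(i <- r) (odd (F i) : nat)).
Proof.
rewrite !(big_morph odd oddD (erefl : odd 0 = false)).
by apply: eq_bigr => i _; rewrite oddb.
Qed.

Lemma sum_odd_ord h : \sum_(x < 2 * h) (odd x : nat) = h.
Proof.
elim: h => [|h IH]; first by rewrite big_ord0.
rewrite -(big_mkord xpredT (fun x => odd x : nat)) (_ : 2 * h.+1 = (2 * h).+2); last by lia.
by rewrite !big_nat_recr //= big_mkord IH mul2n odd_double; lia.
Qed.

Lemma sum_ord_pick v (g : nat -> nat) (e : nat) : e < v ->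
  \sum_(x < v) g x * (e == x) = g e.
Proof.
move=> ev; rewrite (bigD1 (Ordinal ev)) //= eqxx muln1 big1 ?addn0 // => x ne.
by rewrite (_ : e == x = false) ?muln0 //; apply: contraNF ne => /eqP E; apply/eqP/val_inj.
Qed.

(** Negation modulo an even [v] keeps parity, so an entry and its opposite are odd together; an
    empty cell reads as 0 and adds nothing. *)
Lemma sum_odd_pm_mult v (c : option 'I_v) : ~~ odd v ->
  \sum_(x < v) (odd x : nat) * pm_mult x c = 2 * (odd (cell_val c) : nat).
Proof.
case: c => [e|] ev /=; last by rewrite big1 // => x _; rewrite muln0.
have e_lt := ltn_ord e.
under eq_bigr do rewrite mulnDr.
rewrite big_split /= (sum_ord_pick (fun x => odd x : nat)) //.
rewrite (sum_ord_pick (fun x => odd x : nat)) ?ltn_mod; last by lia.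
case: (posnP e) => [->|e0]; first by rewrite subn0 modnn.
by rewrite modn_small; lia.
Qed.

Lemma heffter_not_1_mod4 m n (A : 'M[option 'I_(hv n m 2 1)]_(m, n)) :
  @is_heffter m n n m 2 1 A -> (m * n) %% 4 != 1.
Proof.
case=> _ _ _; have vE : hv n m 2 1 = n * m + 1 by rewrite /hv -mulnA mulKn.
move: A; rewrite mulnC; move: (hv n m 2 1) vE => v vE A cnt [row _].
rewrite {}/inJ in cnt.
apply/eqP => mn; pose h := (n * m + 1) %/ 2.
have vh : v = 2 * h by rewrite /h; lia.
have ev : ~~ odd v by lia.
have oh : odd h by rewrite /h; lia.
(* After doubling, both sides count the odd members of the multiset of entries and their
   opposites. *)
have tot : \sum_(i < m) \sum_(j < n) (odd (cell_val (A i j)) : nat) = h.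
  apply/eqP; rewrite -(@eqn_pmul2l 2) // big_distrr /=; apply/eqP.
  transitivity (\sum_(x < v) (odd x : nat) * \sum_(i < m) \sum_(j < n) pm_mult x (A i j)).
    under [RHS]eq_bigr do rewrite big_distrr /=.
    rewrite exchange_big /=; apply: eq_bigr => i _.
    under [RHS]eq_bigr do rewrite big_distrr /=.
    rewrite exchange_big /= big_distrr /=; apply: eq_bigr => j _.
    by rewrite sum_odd_pm_mult.
  rewrite (eq_bigr (fun x : 'I_v => 2 * (odd x : nat))).
    by rewrite -big_distrr /= {}vh in A cnt row ev *; rewrite sum_odd_ord.
  move=> x _; rewrite cnt; case: ifP => [|_]; last by rewrite mulnC.
  by rewrite divn1 /dvdn modn_small ?ltn_ord // => /eqP ->.
have : odd (\sum_(i < m) \sum_(j < n) (odd (cell_val (A i j)) : nat)) by rewrite tot.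
rewrite odd_sum big1 // => i _; rewrite -odd_sum.
have v2 : 2 %| v by rewrite dvdn2.
have dv : v %| \sum_(j < n) cell_val (A i j) by apply/eqP/row.
by have := dvdn_trans v2 dv; rewrite dvdn2 => /negPf ->.
Qed.

(** Away from x = 0 an empty cell and the entry 0 count alike, so cells can be treated as plain
    numbers. *)
Lemma pm_mult_val v (x : 'I_v) c : 0 < x ->
  pm_mult x c = (cell_val c == x) + ((v - cell_val c) %% v == x).
Proof.
case: c => [e|] x0 //=; rewrite subn0 modnn.
by case: (nat_of_ord x) x0.
Qed.

Lemma cell_val_lt v (c : option 'I_v) : 0 < v -> cell_val c < v.
Proof. by case: c => //= e _; apply: ltn_ord. Qed.

Lemma no_heffter22 (A : 'M[option 'I_(hv 2 2 2 1)]_(2, 2)) : ~ @is_heffter 2 2 2 2 2 1 A.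
Proof.
case=> _ _ _ cnt [row col].
have count (x : nat) : 0 < x < 5 -> \sum_(i < 2) \sum_(j < 2)
    ((cell_val (A i j) == x) + ((5 - cell_val (A i j)) %% 5 == x)) = 2.
  case/andP=> x0 x5; have := cnt (Ordinal (x5 : x < hv 2 2 2 1)).
  rewrite /inJ divn1 /= /dvdn modn_small // (gtn_eqF x0) => E; rewrite -[RHS]E.
  by apply: eq_bigr => i _; apply: eq_bigr => j _; rewrite pm_mult_val.
have := (count 1 isT, count 2 isT, row ord0, row ord_max, col ord0, col ord_max).
rewrite !big_ord_recl !big_ord0 (_ : lift ord0 ord0 = ord_max); last exact: val_inj.
have lt5 i j : cell_val (A i j) < 5 by apply: cell_val_lt.
move: (lt5 ord0 ord0) (lt5 ord0 ord_max) (lt5 ord_max ord0) (lt5 ord_max ord_max).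
move: (cell_val _) (cell_val _) (cell_val _) (cell_val _) => a b c d.
(* All 5^4 value patterns are tried. They fail because zero line sums make the four entries equal up
   to sign, so that 1 and 2 cannot both be met up to sign. *)
by move: a b c d; do 4![case=> [|[|[|[|[|//]]]]]] => _ _ _ _ [[[[[]]]]].
Qed.

Theorem theorem4 (m n : nat) (hm : 2 <= m) (hn : 2 <= n) :
  (exists A : 'M[option 'I_(hv n m 2 1)]_(m, n), @is_heffter m n n m 2 1 A)
  <-> ((m * n) %% 4 != 1 /\ ~ (m = 2 /\ n = 2)).
Proof.
split=> [[A hA]|[mn ne22]].
  split; first exact: heffter_not_1_mod4 hA.
  by case=> m2 n2; subst m n; apply: no_heffter22 hA.
exact: realizable_heffter (realizable_all hm hn mn ne22).
Qed.
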